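(* Let $((\mathfrak g,\mu),\rho,T)$ be a relative Rota-Baxter Lie algebra with $\rho:\mathfrak g\to\mathfrak{gl}(V)$ and $T:V\to\mathfrak g$. Then $\big(\bigoplus_{n\ge0}\mathfrak C^n(\mathfrak g,\rho,T),\mathcal D\big)$, with cochain spaces and operator $\mathcal D$ as defined in the context, is a cochain complex, i.e. $\mathcal D\circ\mathcal D=0$.
   Context: $\mathbf K$ is a field of characteristic $0$; $\mathbb S_{(i,j)}$ denotes $(i,j)$-shuffles. Relative Rota-Baxter Lie algebra: a triple $((\mathfrak g,[\cdot,\cdot]_{\mathfrak g}),\rho,T)$ with $(\mathfrak g,[\cdot,\cdot]_{\mathfrak g})$ a Lie algebra (also written $(\mathfrak g,\mu)$ with $\mu=[\cdot,\cdot]_{\mathfrak g}$), $\rho:\mathfrak g\to\mathfrak{gl}(V)$ a representation, and $T:V\to\mathfrak g$ linear with $[Tu,Tv]_{\mathfrak g}=T(\rho(Tu)(v)-\rho(Tv)(u))$ for all $u,v\in V$. Put $\pi=\mu+\rho$. Nijenhuis-Richardson bracket: on $\bigoplus_{n\ge0}\mathrm{Hom}(\wedge^{n+1}(\mathfrak g\oplus V),\mathfrak g\oplus V)$ (the $n$-th summand in degree $n$), $[P,Q]_{NR}=P\bar\circ Q-(-1)^{pq}Q\bar\circ P$ for $P,Q$ of degrees $p,q$, with $(P\bar\circ Q)(x_1,\dots,x_{p+q+1})=\sum_{\sigma\in\mathbb S_{(q+1,p)}}(-1)^\sigma P(Q(x_{\sigma(1)},\dots,x_{\sigma(q+1)}),x_{\sigma(q+2)},\dots,x_{\sigma(p+q+1)})$.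 Multilinear maps $f:\wedge^k\mathfrak g\otimes\wedge^lV\to\mathfrak g$ (or $\to V$) are regarded as elements of degree $k+l-1$ via $\hat f((x_1,v_1),\dots,(x_{k+l},v_{k+l}))=\sum_{\tau\in\mathbb S_{(k,l)}}(-1)^\tau f(x_{\tau(1)},\dots,x_{\tau(k)},v_{\tau(k+1)},\dots,v_{\tau(k+l)})$, placed in the summand $\mathfrak g$ (respectively $V$). Cochains: $\mathfrak C^0(\mathfrak g,\rho,T)=0$, $\mathfrak C^1(\mathfrak g,\rho,T)=\mathfrak{gl}(\mathfrak g)\oplus\mathfrak{gl}(V)$, and for $n\ge2$, $\mathfrak C^n(\mathfrak g,\rho,T)=\big(\mathrm{Hom}(\wedge^n\mathfrak g,\mathfrak g)\oplus\mathrm{Hom}(\wedge^{n-1}\mathfrak g\otimes V,V)\big)\oplus\mathrm{Hom}(\wedge^{n-1}V,\mathfrak g)$. The operator $\mathcal D:\mathfrak C^n(\mathfrak g,\rho,T)\to\mathfrak C^{n+1}(\mathfrak g,\rho,T)$ is $$\mathcal D(f,\theta)=(-1)^{n-2}\Big(-[\pi,f]_{NR},\ [[\pi,T]_{NR},\theta]_{NR}+\frac1{n!}\underbrace{[\cdots[[}_nf,T]_{NR},T]_{NR},\cdots,T]_{NR}\Big)$$ for $f\in\mathrm{Hom}(\wedge^n\mathfrak g,\mathfrak g)\oplus\mathrm{Hom}(\wedge^{n-1}\mathfrak g\otimes V,V)$, $\theta\in\mathrm{Hom}(\wedge^{n-1}V,\mathfrak g)$ (with $\theta$ absent, i.e.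 $\theta=0$, when $n=1$). *)

(* Defs.v *)
From HB Require Import structures.
From mathcomp Require Import all_boot all_fingroup all_algebra.
From mathcomp Require Import boolp classical_sets functions.

Set Implicit Arguments.
Unset Strict Implicit.
Unset Printing Implicit Defensive.

Import GRing.Theory.
Local Open Scope ring_scope.

(* A multilinear map in n variables is a function of a tuple of arguments
   'I_n -> U.  The K-module structure on a type of functions X -> W is the
   pointwise one. *)
Definition alternating_multilinear (K : fieldType) (n : nat)
    (U W : lmodType K) (f : ('I_n -> U) -> W) : Prop :=
  (forall (i : 'I_n) (x : 'I_n -> U),
      linear (fun u : U => f [eta x with i |-> u])) /\
  (forall (i j : 'I_n) (x : 'I_n -> U), i != j -> x i = x j -> f x = 0).

(* Membership in Hom(wedge^k g (x) wedge^l V, W). *)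
Definition mixed_hom (K : fieldType) (k l : nat) (g V W : lmodType K)
    (f : ('I_k -> g) -> ('I_l -> V) -> W) : Prop :=
  (forall v : 'I_l -> V, alternating_multilinear (fun x => f x v)) /\
  (forall x : 'I_k -> g, alternating_multilinear (f x)).

Definition lie_bracket (K : fieldType) (g : lmodType K) (mu : g -> g -> g) :
    Prop :=
  [/\ forall y, linear (fun x => mu x y), forall x, linear (mu x),
      forall x, mu x x = 0
    & forall x y z, mu x (mu y z) + mu y (mu z x) + mu z (mu x y) = 0].

Definition lie_representation (K : fieldType) (g V : lmodType K)
    (mu : g -> g -> g) (rho : g -> {linear V -> V}) : Prop :=
  (forall (a : K) (x y : g) (v : V),
      rho (a *: x + y) v = a *: rho x v + rho y v) /\
  (forall (x y : g) (v : V),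
      rho (mu x y) v = rho x (rho y v) - rho y (rho x v)).

Record rel_rota_baxter_lie (K : fieldType) (g V : lmodType K) := RelRotaBaxterLie {
  rb_mu : g -> g -> g;
  rb_rho : g -> {linear V -> V};
  rb_T : {linear V -> g};
  rb_muP : lie_bracket rb_mu;
  rb_rhoP : lie_representation rb_mu rb_rho;
  rb_TP : forall u v : V,
        rb_mu (rb_T u) (rb_T v) = rb_T (rb_rho (rb_T u) v - rb_rho (rb_T v) u)
}.

Definition shuffle (i j : nat) (s : 'S_(i + j)) : bool :=
  [forall a : 'I_i, forall b : 'I_i,
     (a < b)%N ==> (s (lshift j a) < s (lshift j b))%N] &&
  [forall a : 'I_j, forall b : 'I_j,
     (a < b)%N ==> (s (rshift i a) < s (rshift i b))%N].

Definition cast_arity (U W : Type) (m n : nat) (e : m = n)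
    (f : ('I_m -> U) -> W) : ('I_n -> U) -> W :=
  fun x => f (fun i => x (cast_ord e i)).

Definition cons_arg (U : Type) (n : nat) (u : U) (x : 'I_n -> U) :
    'I_n.+1 -> U :=
  fun i => if unlift ord0 i is Some j then x j else u.

(* Carrier of the degree n summand of the Nijenhuis-Richardson algebra of L.
   Multilinearity and alternation are not built into the type: they are
   imposed by the cochain spaces below. *)
Definition nr (K : fieldType) (L : lmodType K) (n : nat) : lmodType K :=
  (('I_n.+1 -> L) -> L).

(* The composite P o Q.  The shuffles act on q.+1 + p arguments, hence the
   degree q + p rather than p + q. *)
Definition nr_comp (K : fieldType) (L : lmodType K) (p q : nat)
    (P : nr L p) (Q : nr L q) : nr L (q + p) :=
  fun x : 'I_(q.+1 + p) -> L =>
  \sum_(s : 'S_(q.+1 + p) | shuffle s)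
    ((-1) ^+ s : K) *:
      P (cons_arg (Q (fun i => x (s (lshift p i))))
                  (fun j => x (s (rshift q.+1 j)))).

Definition nr_bracket (K : fieldType) (L : lmodType K) (p q : nat)
    (P : nr L p) (Q : nr L q) : nr L (p + q) :=
  (cast_arity (congr1 S (addnC q p)) (nr_comp P Q) : nr L (p + q))
  - ((-1) ^+ (p * q) : K) *: nr_comp Q P.

Definition hat (K : fieldType) (k l : nat) (g V W : lmodType K)
    (f : ('I_k -> g) -> ('I_l -> V) -> W) : ('I_(k + l) -> g * V) -> W :=
  fun x => \sum_(s : 'S_(k + l) | shuffle s)
    ((-1) ^+ s : K) *: f (fun i => (x (s (lshift l i))).1)
                         (fun j => (x (s (rshift k j))).2).

Definition hat_g (K : fieldType) (k l : nat) (g V : lmodType K)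
    (f : ('I_k -> g) -> ('I_l -> V) -> g) : ('I_(k + l) -> g * V) -> g * V :=
  fun x => (hat f x, 0).

Definition hat_V (K : fieldType) (k l : nat) (g V : lmodType K)
    (f : ('I_k -> g) -> ('I_l -> V) -> V) : ('I_(k + l) -> g * V) -> g * V :=
  fun x => (0, hat f x).

Definition rb_pi (K : fieldType) (g V : lmodType K)
    (A : rel_rota_baxter_lie g V) : nr (g * V)%type 1 :=
  (hat_g (fun (x : 'I_2 -> g) (_ : 'I_0 -> V) =>
            rb_mu A (x ord0) (x ord_max)) : nr (g * V)%type 1)
  + hat_V (fun (x : 'I_1 -> g) (v : 'I_1 -> V) => rb_rho A (x ord0) (v ord0)).

Definition rb_That (K : fieldType) (g V : lmodType K)
    (A : rel_rota_baxter_lie g V) : nr (g * V)%type 0 :=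
  hat_g (fun (_ : 'I_0 -> g) (v : 'I_1 -> V) => rb_T A (v ord0)).

Definition bracket_T (K : fieldType) (g V : lmodType K)
    (A : rel_rota_baxter_lie g V) (n : nat) (f : nr (g * V)%type n) :
    nr (g * V)%type n :=
  cast_arity (congr1 S (addn0 n)) (nr_bracket f (rb_That A)).

(* Ambient space of the n-cochains: zero for n = 0, the degree 0 summand for
   n = 1, pairs (f, theta) of degrees (n - 1, n - 2) for n >= 2. *)
Definition ambient (K : fieldType) (g V : lmodType K) (n : nat) : lmodType K :=
  match n with
  | 0 => 'rV[K]_0
  | 1 => nr (g * V)%type 0
  | m.+2 => (nr (g * V)%type m.+1 * nr (g * V)%type m)%type
  end.

(* The spaces C^n(g, rho, T), as images of the hat embedding. *)
Definition cochain (K : fieldType) (g V : lmodType K) (n : nat) :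
    set (ambient g V n) :=
  match n with
  | 0 => setT
  | 1 => fun f : nr (g * V)%type 0 =>
      exists (a : {linear g -> g}) (b : {linear V -> V}),
        f = (hat_g (fun (x : 'I_1 -> g) (_ : 'I_0 -> V) => a (x ord0))
              : nr (g * V)%type 0)
            + hat_V (fun (_ : 'I_0 -> g) (v : 'I_1 -> V) => b (v ord0))
  | m.+2 => fun c : nr (g * V)%type m.+1 * nr (g * V)%type m =>
      exists (fg : ('I_m.+2 -> g) -> ('I_0 -> V) -> g)
             (fV : ('I_m.+1 -> g) -> ('I_1 -> V) -> V)
             (th : ('I_0 -> g) -> ('I_m.+1 -> V) -> g),
        [/\ mixed_hom fg, mixed_hom fV, mixed_hom th,
            c.1 = (cast_arity (addn0 m.+2) (hat_g fg) : nr (g * V)%type m.+1)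
                  + cast_arity (addn1 m.+1) (hat_V fV)
          & c.2 = hat_g th]
  end.

(* The sign exponent n - 2 is an integer, equal to -1 for n = 1. *)
Definition rb_D (K : fieldType) (g V : lmodType K)
    (A : rel_rota_baxter_lie g V) (n : nat) :
    ambient g V n -> ambient g V n.+1 :=
  match n with
  | 0 => fun _ => 0
  | 1 => fun f : nr (g * V)%type 0 =>
      ((-1 : K) ^ (1%:Z - 2%:Z)) *:
        ((- nr_bracket (rb_pi A) f, (1`!%:R : K)^-1 *: bracket_T A f)
          : nr (g * V)%type 1 * nr (g * V)%type 0)
  | m.+2 => fun c : nr (g * V)%type m.+1 * nr (g * V)%type m =>
      ((-1 : K) ^ (m.+2%:Z - 2%:Z)) *:
        ((- nr_bracket (rb_pi A) c.1,
          (nr_bracket (nr_bracket (rb_pi A) (rb_That A)) c.2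
             : nr (g * V)%type m.+1)
          + ((m.+2)`!%:R : K)^-1 *: iter m.+2 (@bracket_T K g V A m.+1) c.1)
          : nr (g * V)%type m.+2 * nr (g * V)%type m.+1)
  end.

(* The subsets C n of E n, with the maps d n, form a cochain complex of vector
   spaces. *)
Record cochain_complex (K : fieldType) (E : nat -> lmodType K)
    (C : forall n, set (E n)) (d : forall n, E n -> E n.+1) : Prop := {
  cochain_zero : forall n, C n 0;
  cochain_comb : forall n (a : K) (c c' : E n),
    C n c -> C n c' -> C n (a *: c + c');
  differential_closed : forall n (c : E n), C n c -> C n.+1 (d n c);
  differential_linear : forall n (a : K) (c c' : E n),
    C n c -> C n c' -> d n (a *: c + c') = a *: d n c + d n c';
  differential_square : forall n (c : E n), C n c -> d n.+1 (d n c) = 0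
}.

(* Main.v *)
From HB Require Import structures.
Require Import Defs.
From mathcomp Require Import all_boot all_fingroup all_algebra zify.
From mathcomp Require Import boolp classical_sets functions.

(** The space of alternating maps on L = g + V is a graded Lie algebra under
    the Nijenhuis-Richardson bracket, and both components of D are built from
    brackets with pi and T.  Granting the graded Jacobi identity, D o D = 0
    follows from three facts.
    - [pi, pi] = 0, which is the Jacobi identity of g together with the
      representation axiom, so [pi, -] squares to zero ([br_square]).
    - [[pi, T], T] = 0, which is the Rota-Baxter identity.  Bracketing
      [pi, pi] = 0 twice with T then gives [[pi, T], [pi, T]] = 0
      ([br_square_derived]), so [[pi, T], -] squares to zero as well.
    - [-, T] is a derivation, so its n+1-st power sends [pi, f] to
      [pi, f_(n+1)] + (n+1) [[pi, T], f_n], where f_k is the k-th power applied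
      to f ([iter_ad_br]).  Each bracket with T turns one argument in g into
      one in V, and f has only n arguments, hence f_(n+1) = 0 ([weight_gt]).
      What remains is cancelled by the term of D o D that comes from
      [[pi, T], f_n / n!] ([br_pt_iter_ad]).

    The Jacobi identity is proved by induction on arity.  An alternating map is
    determined by its contractions F(u, -, ..., -), and contraction acts on the
    composition of maps by a Leibniz rule ([contract_circ]); hence the graded
    symmetry of the associator ([circ_assoc_sym]) reduces to maps of smaller
    arity, and it implies the Jacobi identity ([br_jacobi]).  For such
    inductions, maps of n arguments are encoded as functions of sequences that
    vanish on sequences of any other length, so that all arities live in one
    type, and a sum over shuffles becomes a sum over the ways to split a
    sequence into two subsequences, which has a simple recursion
    ([sum_shuffle_at_unshuffle_sum]).

    That D preserves the cochain spaces is a matter of gradings.  The map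
    (x, v) |-> (x, 2v) acts on alternating maps, the bracket respects this
    action, and since 2 is not a root of unity in characteristic 0 its
    eigenspaces separate the components Hom(wedge^k g (x) wedge^l V, -): an
    alternating map is in the image of the hat embedding exactly when it is an
    eigenvector for the right power of 2 ([homog_hat], [hat_homog]).  The
    cochain spaces are thus described by an arity and a weight ([cochain1P],
    [cochain2P]), both of which add up under the bracket. *)

Set Implicit Arguments.
Unset Strict Implicit.
Unset Printing Implicit Defensive.

Import GRing.Theory.
Local Open Scope ring_scope.

(** * Linear identities in abelian groups *)

(** Expressions in the operations of an abelian group, for a decision procedure
    by reflection: two of them agree if every atom has the same integer
    coefficient in both. *)
Inductive zexp := ZVar of nat | ZZero | ZAdd of zexp & zexp | ZOpp of zexp.

Fixpoint zeval (M : zmodType) (e : seq M) (t : zexp) : M :=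
  match t with
  | ZVar i => e`_i
  | ZZero => 0
  | ZAdd t1 t2 => zeval e t1 + zeval e t2
  | ZOpp t1 => - zeval e t1
  end.

Fixpoint zcoef (i : nat) (t : zexp) : int :=
  match t with
  | ZVar j => (i == j)%:R
  | ZZero => 0
  | ZAdd t1 t2 => zcoef i t1 + zcoef i t2
  | ZOpp t1 => - zcoef i t1
  end.

Lemma zevalE (M : zmodType) (e : seq M) t :
  zeval e t = \sum_(i < size e) e`_i *~ zcoef i t.
Proof.
elim: t => [j||t1 IH1 t2 IH2|t1 IH1] /=.
- case: (ltnP j (size e)) => jn; last first.
    rewrite nth_default // big1 // => i _.
    by rewrite (ltn_eqF (leq_trans (ltn_ord i) jn)).
  rewrite (bigD1 (Ordinal jn)) //= eqxx big1 ?addr0 // => i.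
  by rewrite -val_eqE /= => /negPf ->.
- by rewrite big1.
- by rewrite IH1 IH2 -big_split; apply: eq_bigr => i _; rewrite mulrzDr.
- by rewrite IH1 -sumrN; apply: eq_bigr => i _; rewrite mulrNz.
Qed.

Lemma zmod_eq (M : zmodType) (e : seq M) t1 t2 :
  all (fun i => zcoef i t1 == zcoef i t2) (iota 0 (size e)) ->
  zeval e t1 = zeval e t2.
Proof.
move=> /allP h; rewrite !zevalE; apply: eq_bigr => i _.
have /h/eqP -> // : (i : nat) \in iota 0 (size e) by rewrite mem_iota ltn_ord.
Qed.

(** Atoms are compared by unification, which leaves no instantiation behind
    because they contain no existential variables. *)
Ltac zindex x e :=
  match e with
  | ?y :: ?e' => let _ := match goal with _ => unify x y end in constr:(0%N)
  | _ :: ?e' => let i := zindex x e' in constr:(S i)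
  end.

Ltac zvars t e :=
  lazymatch t with
  | 0 => e
  | ?t1 + ?t2 => let e1 := zvars t1 e in zvars t2 e1
  | - ?t1 => zvars t1 e
  | _ => match e with
         | _ => let i := zindex t e in e
         | _ => constr:(t :: e)
         end
  end.

Ltac zreify t e :=
  lazymatch t with
  | 0 => constr:(ZZero)
  | ?t1 + ?t2 => let r1 := zreify t1 e in let r2 := zreify t2 e in
                 constr:(ZAdd r1 r2)
  | - ?t1 => let r1 := zreify t1 e in constr:(ZOpp r1)
  | _ => let i := zindex t e in constr:(ZVar i)
  end.

(** Proves identities of abelian groups, scaled vectors counting as atoms. *)
Ltac zmod :=
  match goal with |- @eq ?M ?a ?b =>
    let e0 := constr:(@nil M) in
    let e1 := zvars a e0 in let e2 := zvars b e1 in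
    let ra := zreify a e2 in let rb := zreify b e2 in
    apply: (@zmod_eq _ e2 ra rb); vm_compute; reflexivity
  end.

Lemma signE (R : pzRingType) m : (-1) ^+ m = (if odd m then -1 else 1) :> R.
Proof. by rewrite -signr_odd; case: odd. Qed.

(** * Alternating maps on sequences and their wedge product *)

Section Alternating.
Variables (K : fieldType) (U W : lmodType K).
Implicit Types (F G : seq U -> W) (s A B : seq U) (u v x : U).

(** Alternating n-linear maps, encoded on sequences of any length so that the
    arity is not part of the type.  Vanishing on two equal adjacent arguments is
    enough, by [altern_eq_args]. *)
Definition altern (n : nat) F : Prop :=
  [/\ forall s, size s != n -> F s = 0,
      forall s1 s2, linear (fun u => F (s1 ++ u :: s2))
    & forall s1 s2 u, F (s1 ++ u :: u :: s2) = 0].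

Definition contract (u : U) F : seq U -> W := fun s => F (u :: s).

Lemma altern0 n : altern n (0 : seq U -> W).
Proof. by split=> // s1 s2 a u v; rewrite /= scaler0 addr0. Qed.

Lemma altern_comb n a F G : altern n F -> altern n G -> altern n (a *: F + G).
Proof.
move=> [F0 F1 F2] [G0 G1 G2]; split=> [s hs|s1 s2 b u v|s1 s2 u].
- by rewrite !fctE F0 // G0 // scaler0 addr0.
- rewrite !fctE F1 G1 !scalerDr !scalerA (mulrC a); zmod.
- by rewrite !fctE F2 G2 scaler0 addr0.
Qed.

Lemma alternD n F G : altern n F -> altern n G -> altern n (F + G).
Proof. by move=> hF; rewrite -[F]scale1r; exact: altern_comb. Qed.

Lemma alternZ n a F : altern n F -> altern n (a *: F).
Proof. by move=> hF; rewrite -[a *: F]addr0; apply: altern_comb => //; exact: altern0. Qed.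

Lemma alternN n F : altern n F -> altern n (- F).
Proof. by rewrite -scaleN1r; exact: alternZ. Qed.

Lemma altern_size n F s : altern n F -> size s != n -> F s = 0.
Proof. by case=> h _ _; exact: h. Qed.

Lemma altern_arity m n F : altern m F -> m = n -> altern n F.
Proof. by move=> hF <-. Qed.

Lemma altern_contract n F u : altern n F -> altern n.-1 (contract u F).
Proof.
move=> [F0 F1 F2]; split=> [s hs|s1 s2|s1 s2 v].
- by apply: F0 => /=; apply: contraNneq hs => <-.
- exact: (F1 (u :: s1)).
- exact: (F2 (u :: s1)).
Qed.

Lemma altern_linear n F s1 s2 : altern n F -> linear (fun u => F (s1 ++ u :: s2)).
Proof. by case. Qed.

Lemma altern_nil0 n F s1 s2 : altern n F -> F (s1 ++ 0 :: s2) = 0.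
Proof.
move=> /(altern_linear s1 s2)/(_ (-1) 0 0).
by rewrite scaler0 addr0 scaleN1r addNr.
Qed.

Lemma altern_addl n F s1 s2 u v : altern n F ->
  F (s1 ++ (u + v) :: s2) = F (s1 ++ u :: s2) + F (s1 ++ v :: s2).
Proof.
by move=> /(altern_linear s1 s2)/(_ 1 u v); rewrite !scale1r.
Qed.

Lemma altern_scale n F s1 s2 a u : altern n F ->
  F (s1 ++ (a *: u) :: s2) = a *: F (s1 ++ u :: s2).
Proof.
move=> hF; have /(_ a u 0) := altern_linear s1 s2 hF.
by rewrite addr0 (altern_nil0 _ _ hF) addr0.
Qed.

Lemma altern_swap n F s1 s2 u v : altern n F ->
  F (s1 ++ u :: v :: s2) = - F (s1 ++ v :: u :: s2).
Proof.
move=> hF; have [_ _ F2] := hF.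
have := F2 s1 s2 (u + v); rewrite (altern_addl _ _ _ _ hF).
have E w : F (s1 ++ w :: (u + v) :: s2)
         = F (s1 ++ w :: u :: s2) + F (s1 ++ w :: v :: s2).
  by have := altern_addl (s1 ++ [:: w]) s2 u v hF; rewrite -!catA.
by rewrite !E !F2 add0r addr0 => /eqP; rewrite addr_eq0 => /eqP.
Qed.

(** The step of all inductions on arity: a map is alternating if it is so in
    its first two arguments and if its contractions are alternating. *)
Lemma altern_cons n F : F [::] = 0 -> (forall s, linear (fun u => F (u :: s))) ->
  (forall u s, F (u :: u :: s) = 0) -> (forall u, altern n (contract u F)) ->
  altern n.+1 F.
Proof.
move=> Fn Fl Fa Fc; split=> [s|s1 s2|s1 s2 u].
- by case: s => [|u s] //= hs; have [F0 _ _] := Fc u; apply: F0.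
- case: s1 => [|w s1]; first exact: Fl.
  by have [_ F1 _] := Fc w; exact: (F1 s1 s2).
- case: s1 => [|w s1]; first exact: Fa.
  by have [_ _ F2] := Fc w; exact: (F2 s1 s2).
Qed.

Lemma altern_eq n F G : altern n F -> altern n G ->
  (forall s, size s = n -> F s = G s) -> F = G.
Proof.
move=> [F0 _ _] [G0 _ _] h; apply/funext => s.
by have [/h//|hs] := eqVneq (size s) n; rewrite F0 ?G0.
Qed.

Lemma altern0_contract F u : altern 0 F -> contract u F = 0.
Proof. by move=> hF; apply/funext => s; apply: (altern_size hF). Qed.

(** The signed sum of Phi A B over the ways to split s into complementary
    subsequences A and B, where Phi is meant to vanish unless A has length k.
    Sending the head of s to B moves it past the k entries of A, whence the sign.
    Splittings with A of the wrong length are not excluded by the recursion: they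
    contribute zero because of the support of Phi. *)
Fixpoint unshuffle_sum (k : nat) s (Phi : seq U -> seq U -> W) : W :=
  if s is u :: s' then
    unshuffle_sum k.-1 s' (fun A B => Phi (u :: A) B)
    + ((-1) ^+ k : K) *: unshuffle_sum k s' (fun A B => Phi A (u :: B))
  else Phi [::] [::].

Lemma unshuffle_sum_comb k s a (Phi Psi : seq U -> seq U -> W) :
  unshuffle_sum k s (fun A B => a *: Phi A B + Psi A B) =
  a *: unshuffle_sum k s Phi + unshuffle_sum k s Psi.
Proof.
elim: s k Phi Psi => //= u s IH k Phi Psi.
rewrite (IH _ (fun A B => Phi (u :: A) B)) (IH _ (fun A B => Phi A (u :: B))).
rewrite !scalerDr !scalerA (mulrC a); zmod.
Qed.

Lemma unshuffle_sum_ext k s (Phi Psi : seq U -> seq U -> W) :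
  (forall A B, (size A + size B = size s)%N -> Phi A B = Psi A B) ->
  unshuffle_sum k s Phi = unshuffle_sum k s Psi.
Proof.
elim: s k Phi Psi => /= [|u s IH] k Phi Psi h; first exact: h.
by congr (_ + _ *: _); apply: IH => A B hs; apply: h; rewrite /= ?addSn ?addnS hs.
Qed.

Lemma unshuffle_sum0 k s : unshuffle_sum k s (fun _ _ => 0) = 0.
Proof. by elim: s k => //= u s IH k; rewrite !IH scaler0 addr0. Qed.

Lemma unshuffle_sum_eq0 k s (Phi : seq U -> seq U -> W) :
  (forall A B, (size A + size B = size s)%N -> Phi A B = 0) -> unshuffle_sum k s Phi = 0.
Proof. by move=> h; rewrite (unshuffle_sum_ext k h) unshuffle_sum0. Qed.

Lemma unshuffle_sum_0l s (Phi : seq U -> seq U -> W) :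
  (forall u A B, Phi (u :: A) B = 0) -> unshuffle_sum 0 s Phi = Phi [::] s.
Proof.
elim: s Phi => //= u s IH Phi h.
by rewrite unshuffle_sum_eq0 // add0r expr0 scale1r IH.
Qed.

Definition bialtern k l (Phi : seq U -> seq U -> W) :=
  (forall B, altern k (Phi^~ B)) /\ (forall A, altern l (Phi A)).

Lemma bialternl k l Phi u : bialtern k l Phi ->
  bialtern k.-1 l (fun A B => Phi (u :: A) B).
Proof. by move=> [h1 h2]; split=> [B|A] //; exact: (altern_contract u (h1 B)). Qed.

Lemma bialternr k l Phi u : bialtern k l Phi ->
  bialtern k l.-1 (fun A B => Phi A (u :: B)).
Proof. by move=> [h1 h2]; split=> [B|A] //; exact: (altern_contract u (h2 A)). Qed.

(** The wedge product of alternating maps is alternating.  Two successive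
    contractions by u leave the two mixed terms, where one u goes to each side;
    these carry opposite signs. *)
Lemma altern_unshuffle_sum k l Phi : bialtern k l Phi ->
  altern (k + l)%N (fun s => unshuffle_sum k s Phi).
Proof.
have [n kl] : exists n, (k + l)%N = n by exists (k + l)%N.
rewrite kl.
elim: n k l kl Phi => [|n IH] k l kl Phi hP.
  have [h1 h2] := hP.
  have k0 : k = 0%N by lia.
  have l0 : l = 0%N by lia.
  have ns s : size s != 0%N -> unshuffle_sum k s Phi = 0.
    move=> hs; apply: unshuffle_sum_eq0 => A B E.
    have [hA|hA] := eqVneq (size A) 0%N.
      by apply: (altern_size (h2 A)); lia.
    by apply: (altern_size (h1 B)); lia.
  have n0 (s1 s2 : seq U) u : size (s1 ++ u :: s2) != 0%N.
    by rewrite size_cat /= addnS.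
  split=> // [s1 s2 a u v|s1 s2 u]; last by rewrite ns.
  by rewrite !ns // scaler0 addr0.
have k0 u : k = 0%N -> (fun A B => Phi (u :: A) B) = (fun _ _ => 0).
  move=> k0; apply/funext => A; apply/funext => B.
  by apply: (altern_size (hP.1 B)); rewrite k0.
have l0 u : l = 0%N -> (fun A B => Phi A (u :: B)) = (fun _ _ => 0).
  move=> l0; apply/funext => A; apply/funext => B.
  by apply: (altern_size (hP.2 A)); rewrite l0.
apply: altern_cons => [|s a u v|u s|u] /=.
- have [hk|hk] := eqVneq k 0%N.
    by apply: (altern_size (hP.2 _)) => /=; lia.
  by apply: (altern_size (hP.1 _)) => /=; rewrite eq_sym.
- have -> : (fun A B => Phi ((a *: u + v) :: A) B)
          = (fun A B => a *: Phi (u :: A) B + Phi (v :: A) B).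
    by apply/funext => A; apply/funext => B; apply: (altern_linear [::] A (hP.1 B)).
  have -> : (fun A B => Phi A ((a *: u + v) :: B))
          = (fun A B => a *: Phi A (u :: B) + Phi A (v :: B)).
    by apply/funext => A; apply/funext => B; apply: (altern_linear [::] B (hP.2 A)).
  rewrite (unshuffle_sum_comb _ _ _ (fun A B => Phi (u :: A) B)).
  rewrite (unshuffle_sum_comb _ _ _ (fun A B => Phi A (u :: B))).
  rewrite !scalerDr !scalerA (mulrC a); zmod.
(* Only the terms with one copy of u on each side remain. *)
- rewrite (@unshuffle_sum_eq0 k.-1.-1) => [|A B _]; last first.
    by have [_ _ h] := hP.1 B; exact: (h [::] A u).
  rewrite (@unshuffle_sum_eq0 k s (fun A B => Phi A (u :: u :: B))) => [|A B _]; last first.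
    by have [_ _ h] := hP.2 A; exact: (h [::] B u).
  rewrite scaler0 add0r addr0.
  have [kz|] := eqVneq k 0%N; last first.
    by case: k {IH kl hP k0} => //= k _; rewrite exprS mulN1r scaleNr addrN.
  have z A B : Phi (u :: A) (u :: B) = 0.
    exact: (congr1 (fun f => f A (u :: B)) (k0 u kz)).
  by rewrite !unshuffle_sum_eq0 ?scaler0 ?addr0.
- apply: alternD; last first.
    apply: alternZ; have [lz|hl] := eqVneq l 0%N.
      rewrite l0 //.
      have -> : (fun s => unshuffle_sum k s (fun=> fun=> 0)) = 0 :> (seq U -> W).
        by apply/funext => s; rewrite unshuffle_sum0.
      exact: altern0.
    by apply: (IH k l.-1); [lia|exact: bialternr].
  have [kz|hk] := eqVneq k 0%N.
    rewrite k0 //.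
    have -> : (fun s => unshuffle_sum k.-1 s (fun=> fun=> 0)) = 0 :> (seq U -> W).
      by apply/funext => s; rewrite unshuffle_sum0.
    exact: altern0.
  by apply: (IH k.-1 l); [lia|exact: bialternl].
Qed.
End Alternating.

(** * The Nijenhuis-Richardson bracket and its Jacobi identity *)

Section Composition.
Variables (K : fieldType) (L : lmodType K).
Implicit Types (P Q R : seq L -> L).

(** The composition of P with Q of arity b.  A sum over (b, -)-shuffles is a sum
    over the subsequences A that are fed to Q. *)
Definition circ (b : nat) P Q : seq L -> L :=
  fun s => unshuffle_sum b s (fun A B => P (Q A :: B)).

Lemma bialtern_circ a b P Q : altern a P -> altern b Q ->
  bialtern b a.-1 (fun A B => P (Q A :: B)).
Proof.
move=> hP hQ; split=> [B|A]; last exact: altern_contract hP.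
have [Q0 Q1 Q2] := hQ.
split=> [s hs|s1 s2 c u v|s1 s2 u].
- by rewrite Q0 // (altern_nil0 [::] B hP).
- by rewrite Q1; exact: (altern_linear [::] B hP).
- by rewrite Q2 (altern_nil0 [::] B hP).
Qed.

Lemma altern_circ a b P Q : altern a P -> altern b Q ->
  altern (b + a.-1)%N (circ b P Q).
Proof. by move=> hP hQ; apply: altern_unshuffle_sum; exact: bialtern_circ. Qed.

Lemma circ_combl b c P P' Q :
  circ b (c *: P + P') Q = c *: circ b P Q + circ b P' Q.
Proof.
by apply/funext => s; exact: (unshuffle_sum_comb b s c (fun A B => P (Q A :: B))).
Qed.

Lemma circ_combr a b c P Q Q' : altern a P ->
  circ b P (c *: Q + Q') = c *: circ b P Q + circ b P Q'.
Proof.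
move=> hP; apply/funext => s.
rewrite fctE /circ -[RHS]unshuffle_sum_comb; apply: unshuffle_sum_ext => A B _.
by exact: (altern_linear [::] B hP).
Qed.

Lemma circ_subl b c P P' Q :
  circ b (P - c *: P') Q = circ b P Q - c *: circ b P' Q.
Proof. by rewrite addrC -scaleNr circ_combl scaleNr addrC. Qed.

Lemma circ_subr a b c P Q Q' : altern a P ->
  circ b P (Q - c *: Q') = circ b P Q - c *: circ b P Q'.
Proof. by move=> hP; rewrite addrC -scaleNr (circ_combr _ _ _ _ hP) scaleNr addrC. Qed.

Lemma circ0l b Q : circ b 0 Q = 0.
Proof. by apply/funext => s; apply: unshuffle_sum_eq0. Qed.

Lemma circ0r a b P : altern a P -> circ b P 0 = 0.
Proof.
move=> hP; apply/funext => s; apply: unshuffle_sum_eq0 => A B _.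
exact: (altern_nil0 [::] B hP).
Qed.

Lemma circ_constl b P Q : altern 0 P -> circ b P Q = 0.
Proof.
by move=> hP; apply/funext => s; apply: unshuffle_sum_eq0 => A B _; apply: (altern_size hP).
Qed.

(** Elements of L are the maps of arity 0, and composing with such an element is
    contraction by it.  This makes contraction a special case of composition. *)
Lemma circ_constr a P Q : altern a P -> altern 0 Q ->
  circ 0 P Q = contract (Q [::]) P.
Proof.
move=> hP hQ; apply/funext => s; rewrite /circ unshuffle_sum_0l // => u A B.
by rewrite (altern_size hQ) // (altern_nil0 [::] B hP).
Qed.

(** The argument u goes either to Q or to P; in the second case it comes after
    the value of Q and has to be moved in front of it. *)
Lemma contract_circ a b P Q u : altern a P -> altern b Q ->
  contract u (circ b P Q) =
  circ b.-1 P (contract u Q) - ((-1) ^+ b : K) *: circ b (contract u P) Q.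
Proof.
move=> hP hQ; apply/funext => s; rewrite !fctE /contract /circ /=.
congr (_ + _); rewrite -scalerN; congr (_ *: _).
have := unshuffle_sum_comb b s (-1) (fun A B => P (u :: Q A :: B)) (fun _ _ => 0).
rewrite unshuffle_sum0 addr0 scaleN1r => <-; apply: unshuffle_sum_ext => A B _.
by rewrite scaleN1r addr0; exact: (altern_swap [::] _ _ _ hP).
Qed.

(** The Leibniz rule for contractions, read as a statement on associators; the
    last term on the right vanishes because R takes no argument. *)
Lemma circ_assoc_const a b P Q R : altern a P -> altern b Q -> altern 0 R ->
  circ 0 (circ b P Q) R - circ b.-1 P (circ 0 Q R) =
  ((-1) ^+ b.+1 : K) *: (circ b (circ 0 P R) Q - circ b.-1 P (circ b R Q)).
Proof.
move=> hP hQ hR.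
rewrite (circ_constr (altern_circ hP hQ) hR) (circ_constr hQ hR) (circ_constr hP hR).
rewrite (circ_constl _ _ hR) (circ0r _ hP) (contract_circ _ hP hQ).
by rewrite subr0 addrAC subrr add0r exprS mulN1r scaleNr.
Qed.

(** The right pre-Lie identity.  Contraction by u distributes over the associator
    of P, Q, R as the sum of the associators in which one of the three maps is
    contracted, so the identity follows by induction; it starts when Q or R is an
    element of L. *)
Lemma circ_assoc_sym a b c P Q R : altern a P -> altern b Q -> altern c R ->
  circ c (circ b P Q) R - circ (b + c).-1 P (circ c Q R) =
  ((-1) ^+ (b.+1 * c.+1) : K) *:
    (circ b (circ c P R) Q - circ (b + c).-1 P (circ b R Q)).
Proof.
have [n nE] := ubnP (a + b + c)%N.
elim: n a b c P Q R nE => // n IH a b c P Q R nE hP hQ hR.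
case: c nE hR => [|c] nE hR.
  by rewrite addn0 muln1 (circ_assoc_const hP hQ hR).
case: b nE hQ => [|b] nE hQ.
  rewrite add0n mul1n (circ_assoc_const hP hR hQ) scalerA -exprMn.
  by rewrite mulrNN mulr1 expr1n scale1r.
case: a nE hP => [|a] nE hP.
  by rewrite !(circ_constl _ _ hP) !circ0l !subr0 scaler0.
have PQ := altern_circ hP hQ; have PR := altern_circ hP hR.
have QR := altern_circ hQ hR; have RQ := altern_circ hR hQ.
have hp u := altern_contract u hP; have hq u := altern_contract u hQ.
have hr u := altern_contract u hR.
have eRQ : (b.+1 + c.+1.-1)%N = (c.+1 + b.+1.-1)%N by lia.
rewrite eRQ in RQ.
have eA : (b.+1 + c.+1).-1 = (c.+1 + b.+1.-1)%N by lia.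
rewrite eA.
(* All three maps have arguments now, so both sides have positive arity: they
   vanish on the empty sequence and are determined by their contractions. *)
apply/funext => -[|u s].
  have ePQ : (b.+1 + a.+1.-1)%N = (b + a).+1 by lia.
  have ePR : (c.+1 + a.+1.-1)%N = (c + a).+1 by lia.
  have A1 := altern_circ PQ hR; have A2 := altern_circ PR hQ.
  have A3 := altern_circ hP QR; have A4 := altern_circ hP RQ.
  rewrite !fctE (altern_size A1) ?(altern_size A2) ?(altern_size A3)
    ?(altern_size A4) ?subr0 ?scaler0 //; lia.
have E F G : contract u F = contract u G -> F (u :: s) = G (u :: s).
  by move=> h; exact: (congr1 (@^~ s) h).
apply: E.
have cB F G : contract u (F - G) = contract u F - contract u G by [].
have cZ (x : K) F : contract u (x *: F) = x *: contract u F by [].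
rewrite cZ !cB.
rewrite (contract_circ u PQ hR) (contract_circ u PR hQ).
rewrite (contract_circ u hP QR) (contract_circ u hP RQ).
rewrite (contract_circ u hP hQ) (contract_circ u hP hR).
rewrite (contract_circ u hQ hR) (contract_circ u hR hQ) /=.
rewrite !circ_subl !(circ_subr _ _ _ _ hP).
have := IH a.+1 b.+1 c _ _ _ _ hP hQ (hr u).
have := IH a.+1 b c.+1 _ _ _ _ hP (hq u) hR.
have := IH a b.+1 c.+1 _ _ _ _ (hp u) hQ hR.
rewrite /= !addnS !addSn (addnC c b) /=.
move=> /(_ _)/eqP; rewrite subr_eq => /(_ ltac:(lia))/eqP ->.
move=> /(_ _)/eqP; rewrite subr_eq => /(_ ltac:(lia))/eqP ->.
move=> /(_ _)/eqP; rewrite subr_eq => /(_ ltac:(lia))/eqP ->.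
rewrite !signE !oddM /= !oddD /=.
case: (odd b); case: (odd c); rewrite /= !(scaleN1r, scale1r); zmod.
Qed.

(** The bracket of P and Q of degrees p and q, that is of arities p+1 and q+1. *)
Definition br p q P Q : seq L -> L :=
  circ q.+1 P Q - ((-1) ^+ (p * q) : K) *: circ p.+1 Q P.

Lemma altern_br p q P Q : altern p.+1 P -> altern q.+1 Q ->
  altern (p + q).+1 (br p q P Q).
Proof.
move=> hP hQ; have A1 := altern_circ hP hQ; have A2 := altern_circ hQ hP.
rewrite /= addSn in A1 A2; rewrite addnC in A1.
by apply: alternD => //; apply: alternN; apply: alternZ.
Qed.

Lemma br_combl p q c P P' Q : altern q.+1 Q ->
  br p q (c *: P + P') Q = c *: br p q P Q + br p q P' Q.
Proof.
move=> hQ; rewrite /br circ_combl (circ_combr _ _ _ _ hQ).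
rewrite !(scalerDr, scalerN) !scalerA (mulrC c); zmod.
Qed.

Lemma br_combr p q c P Q Q' : altern p.+1 P ->
  br p q P (c *: Q + Q') = c *: br p q P Q + br p q P Q'.
Proof.
move=> hP; rewrite /br circ_combl (circ_combr _ _ _ _ hP).
rewrite !(scalerDr, scalerN) !scalerA (mulrC c); zmod.
Qed.

Lemma br0r p q P : altern p.+1 P -> br p q P 0 = 0.
Proof. by move=> hP; rewrite /br (circ0r _ hP) circ0l scaler0 subr0. Qed.

Lemma brZr p q c P Q : altern p.+1 P -> br p q P (c *: Q) = c *: br p q P Q.
Proof. by move=> hP; have := br_combr q c Q 0 hP; rewrite br0r // !addr0. Qed.

Lemma brNr p q P Q : altern p.+1 P -> br p q P (- Q) = - br p q P Q.
Proof. by move=> hP; rewrite -!scaleN1r brZr. Qed.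

Lemma brDr p q P Q Q' : altern p.+1 P -> br p q P (Q + Q') = br p q P Q + br p q P Q'.
Proof. by move=> hP; have := br_combr q 1 Q Q' hP; rewrite !scale1r. Qed.

Lemma br0l p q Q : altern q.+1 Q -> br p q 0 Q = 0.
Proof. by move=> hQ; rewrite /br (circ0r _ hQ) circ0l scaler0 subr0. Qed.

(** The commutator of a pre-Lie product satisfies the Jacobi identity: each of
    the three left-nested products is rewritten with the pre-Lie identity, and
    the remaining terms cancel. *)
Lemma br_jacobi p q r P Q R : altern p.+1 P -> altern q.+1 Q -> altern r.+1 R ->
  br (p + q) r (br p q P Q) R =
  br p (q + r) P (br q r Q R) + ((-1) ^+ (q * r) : K) *: br (p + r) q (br p r P R) Q.
Proof.
move=> hP hQ hR.
rewrite /br !circ_subl !(circ_subr _ _ _ _ hP) !(circ_subr _ _ _ _ hQ).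
rewrite !(circ_subr _ _ _ _ hR).
have /eqP := circ_assoc_sym hP hQ hR; rewrite subr_eq => /eqP ->.
have /eqP := circ_assoc_sym hQ hP hR; rewrite subr_eq => /eqP ->.
have /eqP := circ_assoc_sym hR hP hQ; rewrite subr_eq => /eqP ->.
rewrite !addSn !addnS /=.
rewrite !signE !oddM /= !oddD /=.
case: (odd p); case: (odd q); case: (odd r); rewrite /= !(scaleN1r, scale1r); zmod.
Qed.

Section TwoNeq0.
Hypothesis two_neq0 : (2%:R : K) != 0.

Lemma mulr2n_eq0 (F : seq L -> L) : F + F = 0 -> F = 0.
Proof.
move=> h; have : (2%:R : K) *: F = 0 by rewrite scaler_nat mulr2n.
move=> /(congr1 ( *:%R (2%:R^-1 : K))).
by rewrite scalerA mulVf // scale1r scaler0.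
Qed.

(** For d odd, the Jacobi identity of d, d, P reads [[d, d], P] = 2 [d, [d, P]]. *)
Lemma br_square p d P : altern 2 d -> br 1 1 d d = 0 -> altern p.+1 P ->
  br 1 p.+1 d (br 1 p d P) = 0.
Proof.
move=> hd hdd hP; apply: mulr2n_eq0.
have hdP := altern_br hd hP.
have := br_jacobi hd hd hP; rewrite hdd br0l // => /esym; rewrite mul1n !add1n.
have -> : br p.+1 1 (br 1 p d P) d = ((-1) ^+ p : K) *: br 1 p.+1 d (br 1 p d P).
  move: (br 1 p d P) => X.
  rewrite /br muln1 mul1n exprS mulN1r !scaleNr !opprK scalerDr scalerA.
  by rewrite -exprMn mulrNN mulr1 expr1n scale1r addrC.
by rewrite scalerA -exprMn mulrNN mulr1 expr1n scale1r.
Qed.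

(** Bracketing [d, d] = 0 with t gives [d, [d, t]] = 0; bracketing once more
    gives [d, [[d, t], t]] + [[d, t], [d, t]] = 0. *)
Lemma br_square_derived d t : altern 2 d -> altern 1 t -> br 1 1 d d = 0 ->
  br 1 0 (br 1 0 d t) t = 0 -> br 1 1 (br 1 0 d t) (br 1 0 d t) = 0.
Proof.
move=> hd ht hdd htt.
have hdt := altern_br hd ht.
have sym P Q : br 1 1 P Q = br 1 1 Q P.
  by rewrite /br mul1n expr1 !scaleN1r !opprK addrC.
have leib P Q : altern 2 P -> altern 2 Q -> br 2 0 (br 1 1 P Q) t =
    br 1 1 P (br 1 0 Q t) + br 1 1 (br 1 0 P t) Q.
  by move=> hP hQ; have := br_jacobi hP hQ ht; rewrite muln0 expr0 scale1r.
have h1 : br 1 1 d (br 1 0 d t) = 0.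
  apply: mulr2n_eq0; have := leib _ _ hd hd.
  by rewrite hdd br0l // (sym (br 1 0 d t)).
by have := leib _ _ hd hdt; rewrite h1 htt br0l // br0r // add0r.
Qed.

End TwoNeq0.

(** The Leibniz formula for the k-th power of the derivation [-, t], which stops
    after two terms because [[d, t], t] = 0. *)
Lemma iter_ad_br q d t F k : altern 2 d -> altern 1 t ->
  br 1 0 (br 1 0 d t) t = 0 -> altern q.+1 F ->
  let ad n G := br n 0 G t in
  iter k (ad q.+1) (br 1 q d F) =
  br 1 q d (iter k (ad q) F) + (k%:R : K) *: br 1 q (br 1 0 d t) (iter k.-1 (ad q) F).
Proof.
move=> hd ht htt hF ad.
have hdt : altern 2 (br 1 0 d t) := altern_br hd ht.
have hi j : altern q.+1 (iter j (ad q) F).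
  by elim: j => //= j IH; have := altern_br IH ht; rewrite addn0.
have leib P Q : altern 2 P -> altern q.+1 Q -> ad q.+1 (br 1 q P Q) =
    br 1 q P (ad q Q) + br 1 q (br 1 0 P t) Q.
  by move=> hP hQ; have := br_jacobi hP hQ ht; rewrite muln0 expr0 scale1r !addn0 add1n.
elim: k => [|k IH]; first by rewrite scale0r addr0.
rewrite iterS IH {1}/ad addrC br_combl // -!/(ad q.+1 _) !leib //.
rewrite htt br0l // addr0 -natr1 scalerDl scale1r addrC -addrA; congr (_ + _).
case: k {IH} => [|k]; first by rewrite !scale0r addr0 add0r.
by rewrite addrC.
Qed.

End Composition.

(** * Sums over shuffles *)

(** The permutations with s i = j are those induced by a permutation of the
    remaining points. *)
Lemma big_lift_perm (R : nmodType) n (i j : 'I_n.+1) (P : pred 'S_n.+1) (F : 'S_n.+1 -> R) :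
  \sum_(s : 'S_n.+1 | P s && (s i == j)) F s =
  \sum_(t : 'S_n | P (lift_perm i j t)) F (lift_perm i j t).
Proof.
have lift_perm_onto (s : 'S_n.+1) : s i = j -> exists t, lift_perm i j t = s.
  move=> sij; pose f k := odflt k (unlift j (s (lift i k))).
  have fK k : lift j (f k) = s (lift i k).
    rewrite /f; case: unliftP => [k' -> //|]; rewrite -sij => /perm_inj e.
    by have := neq_lift i k; rewrite e eqxx.
  have f_inj : injective f.
    by move=> k k' /(congr1 (lift j)); rewrite !fK => /perm_inj/lift_inj.
  exists (perm f_inj); apply/permP => k; case: (unliftP i k) => [k'|] ->.
    by rewrite lift_perm_lift permE fK.
  by rewrite lift_perm_id.
have lift_perm_inj : injective (lift_perm i j : 'S_n -> 'S_n.+1).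
  move=> t t' e; apply/permP => k; apply: (@lift_inj _ j).
  by rewrite -!(lift_perm_lift i) e.
(* A total inverse of lift_perm i j, meaningful on the permutations with
   s i = j. *)
pose unlift_perm s := odflt 1%g [pick t | lift_perm i j t == s].
rewrite (reindex_onto (lift_perm i j) unlift_perm); last first.
  move=> s /andP[_ /eqP /lift_perm_onto[t e]]; rewrite /unlift_perm.
  by case: pickP => [t' /eqP //|/(_ t)]; rewrite e eqxx.
apply: eq_bigl => t; rewrite lift_perm_id eqxx andbT /unlift_perm.
case: pickP => [t' /eqP/lift_perm_inj -> /=|/(_ t)]; last by rewrite eqxx.
by rewrite eqxx andbT.
Qed.

(** (k, n - k)-shuffles of n points, with the position k of the cut separated
    from n so that no cast is needed when n and k vary in an induction. *)
Definition shuffle_at k n (s : 'S_n) : bool :=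
  [forall i : 'I_n, forall j : 'I_n,
     ((i < j)%N && ((j < k) || (k <= i))%N) ==> (s i < s j)%N].

Lemma shuffle_atP k n (s : 'S_n) :
  reflect (forall i j : 'I_n, (i < j)%N -> ((j < k) || (k <= i))%N -> (s i < s j)%N)
          (shuffle_at k s).
Proof.
apply: (iffP forallP) => [h i j ij kij|h i].
  by have /forallP/(_ j) := h i; rewrite ij kij.
by apply/forallP => j; apply/implyP => /andP[]; exact: h.
Qed.

(** Removing the smallest value from a shuffle leaves a shuffle.  The value sits
    at the start of the second block or at the start of the first one; in the
    latter case the first block gets shorter. *)
Lemma shuffle_at_lift k n (i : 'I_n.+1) (t : 'S_n) (k' : nat) :
  (i = k' :> nat /\ k = k') \/ (i = 0%N :> nat /\ k' = k.+1) ->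
  shuffle_at k' (lift_perm i ord0 t) = shuffle_at k t.
Proof.
move=> hik; apply/shuffle_atP/shuffle_atP => h a b.
  move=> ab kab; have := h (lift i a) (lift i b).
  rewrite !lift_perm_lift !lift0 /= /bump.
  by rewrite !ltnS; apply; lia.
case: (unliftP i a) => [a'|] ->; case: (unliftP i b) => [b'|] ->.
- rewrite !lift_perm_lift !lift0 /= /bump ltnS => ab kab; apply: h; lia.
- rewrite /= /bump; lia.
- by rewrite lift_perm_id lift_perm_lift lift0.
- by rewrite ltnn.
Qed.

(** Each block is increasing, so the smallest value starts one of them. *)
Lemma shuffle_at_min k n (s : 'S_n.+1) : shuffle_at k s ->
  (s ord0 = ord0) \/ exists2 i : 'I_n.+1, i = k :> nat & s i = ord0.
Proof.
move=> /shuffle_atP h; pose i := (s^-1)%g ord0.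
have si : s i = ord0 by rewrite permKV.
have [i0|i0] := eqVneq i ord0; first by left; move: si; rewrite i0.
have ip : (0 < i)%N by rewrite lt0n.
have [ik|ki|ik] := ltngtP i k; last by right; exists i.
  by have := h ord0 i ip; rewrite ik si => /(_ isT).
have kn : (k < n.+1)%N by exact: ltn_trans ki _.
by have := h (Ordinal kn) i ki; rewrite leqnn orbT si => /(_ isT).
Qed.

Lemma map_enum_lift (T : Type) n (y : 'I_n.+1 -> T) (k : 'I_n.+1) :
  let z := [seq y (lift k i) | i <- enum 'I_n] in
  [seq y i | i <- enum 'I_n.+1] = take k z ++ y k :: drop k z.
Proof.
move=> z; have sz : size z = n by rewrite size_map size_enum_ord.
have kn : (k <= n)%N by rewrite -ltnS.
have tk : size (take k z) = k by rewrite size_takel // sz.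
apply: (@eq_from_nth _ (y k)) => [|j].
  rewrite size_map size_enum_ord size_cat /= tk size_drop sz; lia.
rewrite size_map size_enum_ord => jn.
rewrite (nth_map k) ?size_enum_ord // (_ : nth k _ j = Ordinal jn); last first.
  by apply: val_inj; rewrite /= nth_enum_ord.
rewrite nth_cat tk.
case: (unliftP k (Ordinal jn)) => [i|] Ej; rewrite Ej; last first.
  by move: Ej => /(congr1 val) /= ->; rewrite ltnn subnn.
move: Ej => /(congr1 val) /= ->; rewrite /bump.
have zi : nth (y k) z i = y (lift k i).
  rewrite (nth_map i) ?size_enum_ord // (_ : nth i _ i = i) //.
  by apply: val_inj; rewrite /= nth_enum_ord.
have [ki|ik] := leqP k i; last by rewrite add0n ik nth_take // zi.
rewrite add1n ltnNge ltnW // subSn //= nth_drop subnKC //.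
Qed.

Section ShuffleSum.
Variables (K : fieldType) (U W : lmodType K).

Definition reorder n (xs : seq U) (s : 'S_n) : seq U :=
  [seq xs`_(s i) | i <- enum 'I_n].

Lemma size_reorder n xs (s : 'S_n) : size (reorder xs s) = n.
Proof. by rewrite size_map size_enum_ord. Qed.

Lemma reorder_lift n u (xs : seq U) (k : 'I_n.+1) (s : 'S_n) :
  reorder (u :: xs) (lift_perm k ord0 s) =
  take k (reorder xs s) ++ u :: drop k (reorder xs s).
Proof.
rewrite /reorder (map_enum_lift _ k) lift_perm_id.
have -> // : [seq (u :: xs)`_(lift_perm k ord0 s (lift k i)) | i <- enum 'I_n]
  = [seq xs`_(s i) | i <- enum 'I_n].
by apply: eq_map => i; rewrite lift_perm_lift lift0.
Qed.

(** Shuffles correspond to splittings of a sequence.  The recursion of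
    [unshuffle_sum] is the case distinction on the block that contains the
    smallest value; a smallest value at position k contributes the sign (-1)^k. *)
Lemma sum_shuffle_at_unshuffle_sum n k (xs : seq U) (Phi : seq U -> seq U -> W) :
  size xs = n -> (k <= n)%N -> (forall A B, size A != k -> Phi A B = 0) ->
  \sum_(s : 'S_n | shuffle_at k s)
     ((-1) ^+ s : K) *: Phi (take k (reorder xs s)) (drop k (reorder xs s)) =
  unshuffle_sum k xs Phi.
Proof.
move=> <- {n}; elim: xs k Phi => [|u xs IH] k Phi.
  rewrite leqn0 => /eqP -> _; rewrite (bigD1 1%g) /=; last first.
    by apply/shuffle_atP => -[].
  rewrite odd_perm1 expr0 scale1r big1 ?addr0; last first.
    by move=> s /andP[_ /eqP[]]; apply/permP => -[].
  have -> // : reorder [::] (1%g : 'S_0) = [::].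
  by apply: size0nil; rewrite size_reorder.
rewrite /= => kn hPhi.
rewrite (bigID (fun s : 'S_(size xs).+1 => (0 < k)%N && (s ord0 == ord0))) /=.
congr (_ + _).
  have [k0|k0] := posnP k.
    rewrite big1 => [|s]; last by rewrite andbF.
    by rewrite unshuffle_sum_eq0 // => A B _; rewrite hPhi // k0.
  rewrite big_lift_perm /= -IH; last first.
    by move=> A B hA; apply: hPhi => /=; lia.
    by lia.
  rewrite -(prednK k0); apply: eq_big => s.
    by apply: shuffle_at_lift; right.
  move=> _; rewrite odd_lift_perm /= reorder_lift take0 drop0 /=.
  by [].
have [nk|kn'] := ltnP (size xs) k.
  have ke : k = (size xs).+1 by apply/eqP; rewrite eqn_leq nk kn.
  rewrite unshuffle_sum_eq0 ?scaler0 => [|A B AB]; last by apply: hPhi; lia.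
  rewrite big1 // => s /andP[/shuffle_at_min []] .
    by move=> ->; rewrite eqxx andbT ke.
  by case=> i ik _; have := ltn_ord i; rewrite ik ke ltnn.
have [i ik] : exists i : 'I_(size xs).+1, i = k :> nat.
  by exists (Ordinal (kn' : (k < (size xs).+1)%N)).
rewrite -IH //; last by move=> A B hA; exact: hPhi.
rewrite scaler_sumr.
rewrite (eq_bigl (fun s => shuffle_at k s && (s i == ord0))) => [|s]; last first.
  have [/[dup] hs|//] := boolP (shuffle_at k s); move=> /shuffle_at_min[s0|[j jk sj]].
    rewrite s0 eqxx andbT -eqn0Ngt /=.
    by rewrite -s0 (inj_eq perm_inj) -val_eqE /= ik.
  have -> : i = j by apply: val_inj; rewrite /= ik jk.
  rewrite sj eqxx (_ : (s ord0 == ord0) = (k == 0%N)); first by case: (k).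
  by rewrite -{2}sj (inj_eq perm_inj) -val_eqE /= jk eq_sym.
rewrite big_lift_perm; apply: eq_big => s.
  by apply: shuffle_at_lift; left.
move=> _; rewrite odd_lift_perm addbF scalerA -signr_odd -ik oddb signr_addb signr_odd.
have tk : size (take i (reorder xs s)) = i by rewrite size_takel // size_reorder ik.
rewrite reorder_lift take_cat drop_cat tk ltnn subnn take0 drop0 cats0.
by [].
Qed.

End ShuffleSum.

(** * From functions of tuples to functions of sequences *)

Section Sequences.
Variables (K : fieldType) (U W : lmodType K).
Implicit Types (n : nat) (F : seq U -> W).

(** Zero off length n, so that [on_seq f] satisfies the support condition of
    [altern]; the default value of nth does not matter on length n. *)
Definition on_seq n (f : ('I_n -> U) -> W) : seq U -> W :=
  fun s => if size s == n then f (fun i => s`_i) else 0.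

Definition of_seq n F : ('I_n -> U) -> W := fun x => F [seq x i | i <- enum 'I_n].
Arguments of_seq : clear implicits.

Lemma nth_map_enum n (x : 'I_n -> U) (i : 'I_n) : [seq x i | i <- enum 'I_n]`_i = x i.
Proof.
rewrite (nth_map i) ?size_enum_ord //; congr x.
by apply: val_inj; rewrite /= nth_enum_ord.
Qed.

Lemma map_enum_nth n (s : seq U) : size s = n -> [seq s`_(i : 'I_n) | i <- enum 'I_n] = s.
Proof.
move=> <-; apply: (@eq_from_nth _ 0) => [|i].
  by rewrite size_map size_enum_ord.
rewrite size_map size_enum_ord => h.
by rewrite (nth_map_enum (fun j : 'I_(size s) => s`_j) (Ordinal h)).
Qed.

Lemma on_seqK n (f : ('I_n -> U) -> W) : of_seq n (on_seq f) = f.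
Proof.
apply/funext => x; rewrite /of_seq /on_seq size_map size_enum_ord eqxx; congr f.
by apply/funext => i; rewrite nth_map_enum.
Qed.

Lemma on_seq_inj n : injective (@on_seq n).
Proof. by move=> f g h; rewrite -(on_seqK f) h on_seqK. Qed.

Lemma on_seq_comb n a (f h : ('I_n -> U) -> W) :
  on_seq (a *: f + h) = a *: on_seq f + on_seq h.
Proof.
by apply/funext => s; rewrite !fctE /on_seq; case: ifP; rewrite ?scaler0 ?addr0.
Qed.

Lemma on_seq0 n : on_seq (0 : ('I_n -> U) -> W) = 0.
Proof. by apply/funext => s; rewrite /on_seq; case: ifP. Qed.

Lemma on_seqD n (f h : ('I_n -> U) -> W) : on_seq (f + h) = on_seq f + on_seq h.
Proof. by have := on_seq_comb 1 f h; rewrite !scale1r. Qed.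

Lemma on_seqZ n a (f : ('I_n -> U) -> W) : on_seq (a *: f) = a *: on_seq f.
Proof. by have := on_seq_comb a f 0; rewrite on_seq0 !addr0. Qed.

Lemma on_seqN n (f : ('I_n -> U) -> W) : on_seq (- f) = - on_seq f.
Proof. by rewrite -scaleN1r on_seqZ scaleN1r. Qed.

Lemma on_seq_cast m n (e : m = n) (f : ('I_m -> U) -> W) : on_seq (cast_arity e f) = on_seq f.
Proof. by apply/funext => s; rewrite /on_seq /cast_arity; case: n / e. Qed.

Lemma altern_on_seq n (f : ('I_n -> U) -> W) :
  alternating_multilinear f -> altern n (on_seq f).
Proof.
move=> [f1 f2]; split=> [s /negPf hs|s1 s2 a u v|s1 s2 u]; rewrite /on_seq.
- by rewrite hs.
- rewrite !size_cat /=; case: eqVneq => [hs|_]; last by rewrite scaler0 addr0.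
  have hi : (size s1 < n)%N by rewrite -hs addnS ltnS leq_addr.
  have E w : (fun i : 'I_n => (s1 ++ w :: s2)`_i)
     = [eta (fun i : 'I_n => (s1 ++ 0 :: s2)`_i) with Ordinal hi |-> w].
    apply/funext => i /=; rewrite -val_eqE /= !nth_cat.
    have [->|ne] := eqVneq; first by rewrite ltnn subnn.
    case: ltnP => // h; have lt : (size s1 < i)%N.
      by rewrite ltn_neqAle eq_sym ne.
    by rewrite -(prednK (n := (i - size s1)%N)) // subn_gt0.
  by rewrite (E (a *: u + v)) (E u) (E v) f1.
- rewrite !size_cat /=; case: eqVneq => [hs|//].
  have hi : (size s1 < n)%N by rewrite -hs !addnS ltnS; lia.
  have hj : ((size s1).+1 < n)%N by rewrite -hs !addnS; lia.
  (* The two equal arguments sit at positions size s1 and (size s1).+1. *)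
  apply: (f2 (Ordinal hi) (Ordinal hj)); first by rewrite -val_eqE /= neq_ltn ltnSn.
  by rewrite /= !nth_cat ltnn subnn ltnNge leqnSn /= subSn // subnn.
Qed.

(** Two equal arguments are moved next to each other by adjacent swaps. *)
Lemma altern_eq_args n F s1 s2 s3 u : altern n F -> F (s1 ++ u :: s2 ++ u :: s3) = 0.
Proof.
move=> hF; elim: s2 s1 => [|v s2 IH] s1 /=; first by case: hF => _ _ ->.
rewrite (altern_swap _ _ _ _ hF); have := IH (s1 ++ [:: v]); rewrite -catA /= => ->.
by rewrite oppr0.
Qed.

Lemma alternating_of_seq n F : altern n F -> alternating_multilinear (of_seq n F).
Proof.
move=> hF; split=> [i x a u v|i j x].
  pose s1 := take i [seq x k | k <- enum 'I_n].
  pose s2 := drop i.+1 [seq x k | k <- enum 'I_n].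
  have E w : [seq [eta x with i |-> w] k | k <- enum 'I_n] = s1 ++ w :: s2.
    have sn : size [seq x k | k <- enum 'I_n] = n by rewrite size_map size_enum_ord.
    have st : size s1 = i by rewrite size_takel // sn ltnW.
    apply: (@eq_from_nth _ 0) => [|k].
      rewrite size_map size_enum_ord size_cat /= st size_drop sn; have := ltn_ord i; lia.
    rewrite size_map size_enum_ord => h.
    rewrite (nth_map_enum _ (Ordinal h)) nth_cat st /= -val_eqE /=.
    have [->|ne] := eqVneq; first by rewrite ltnn subnn.
    case: ltnP => lt; first by rewrite nth_take // (nth_map_enum x (Ordinal h)).
    have lt' : (i < k)%N by rewrite ltn_neqAle eq_sym ne.
    rewrite -(prednK (n := (k - i)%N)) ?subn_gt0 //= nth_drop.
    rewrite (_ : (i.+1 + (k - i).-1)%N = k); last by lia.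
    by rewrite (nth_map_enum x (Ordinal h)).
  by rewrite /of_seq !E (altern_linear s1 s2 hF).
wlog ij : i j / (i < j)%N.
  move=> H ne; case: (ltngtP i j) => [lt|lt|/val_inj e]; first exact: H.
    by move=> /esym; apply: H => //; rewrite eq_sym.
  by rewrite e eqxx in ne.
move=> _ xij; rewrite /of_seq.
set s := [seq _ | _ <- _].
have sn : size s = n by rewrite size_map size_enum_ord.
have -> : s = take i s ++ x i :: (take (j - i.+1) (drop i.+1 s) ++ x i :: drop j.+1 s).
  rewrite -{1}(cat_take_drop i s); congr (_ ++ _).
  rewrite (drop_nth 0) ?sn // nth_map_enum; congr (_ :: _).
  rewrite -{1}(cat_take_drop (j - i.+1) (drop i.+1 s)); congr (_ ++ _).
  rewrite drop_drop (_ : (j - i.+1 + i.+1)%N = j); last by lia.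
  by rewrite (drop_nth 0) ?sn // nth_map_enum xij.
exact: altern_eq_args hF.
Qed.

Lemma shuffleE i j (s : 'S_(i + j)) : shuffle s = shuffle_at i s.
Proof.
apply/andP/shuffle_atP => [[/forallP h1 /forallP h2] a b|h].
  rewrite -(fintype.splitK a) -(fintype.splitK b).
  case: (fintype.split a) => a'; case: (fintype.split b) => b' /= ab kab.
  - by have /forallP/(_ b')/implyP := h1 a'; apply.
  - by have := ltn_ord a'; lia.
  - by have := ltn_ord b'; lia.
  - by have /forallP/(_ b')/implyP := h2 a'; apply; lia.
split; apply/forallP => a; apply/forallP => b; apply/implyP => ab; apply: h => //=.
  by rewrite ltn_ord.
by rewrite ltn_add2l.
by rewrite leq_addr orbT.
Qed.

(** Both the composition of maps and the hat embedding are instances of the left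
    hand side, for different Psi. *)
Lemma shuffle_unshuffle_sum i j (Psi : ('I_i -> U) -> ('I_j -> U) -> W) xs :
  on_seq (fun x => \sum_(s : 'S_(i + j) | shuffle s) ((-1) ^+ s : K) *:
     Psi (fun a => x (s (lshift j a))) (fun b => x (s (rshift i b)))) xs =
  unshuffle_sum i xs (fun A B => if (size A == i) && (size B == j)
                        then Psi (fun a => A`_a) (fun b => B`_b) else 0).
Proof.
rewrite /on_seq; have [sxs|hs] := eqVneq; last first.
  rewrite unshuffle_sum_eq0 // => A B AB; case: andP => // -[/eqP hA /eqP hB].
  by rewrite -AB hA hB eqxx in hs.
rewrite -(sum_shuffle_at_unshuffle_sum sxs (leq_addr _ _)); last by move=> A B /negPf ->.
apply: eq_big => s; first exact: shuffleE.
move=> _; congr (_ *: _).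
have sr := size_reorder xs s.
rewrite size_takel ?sr ?leq_addr // size_drop sr addKn !eqxx /=.
congr (Psi _ _); apply/funext => a.
  by rewrite nth_take // (nth_map_enum (fun k => xs`_(s k)) (lshift j a)).
by rewrite nth_drop (nth_map_enum (fun k => xs`_(s k)) (rshift i a)).
Qed.

End Sequences.

Section NrSequences.
Variables (K : fieldType) (L : lmodType K).

Lemma on_seq_nr_comp p q (P : nr L p) (Q : nr L q) :
  altern p.+1 (on_seq P) -> on_seq (nr_comp P Q) = circ q.+1 (on_seq P) (on_seq Q).
Proof.
move=> hP; apply/funext => xs.
rewrite (shuffle_unshuffle_sum (fun y z => P (cons_arg (Q y) z))) /circ.
apply: unshuffle_sum_ext => A B _.
have [sA|/negPf sA] := eqVneq (size A) q.+1; last first.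
  by rewrite {2}/on_seq sA (altern_nil0 [::] B hP).
have [sB|/negPf sB] := eqVneq (size B) p; last by rewrite /on_seq /= eqSS sB.
rewrite /on_seq sA /= sB !eqxx; congr P; apply/funext => i.
by rewrite /cons_arg; case: unliftP => [j|] -> //=.
Qed.

Lemma on_seq_nr_bracket p q (P : nr L p) (Q : nr L q) :
  altern p.+1 (on_seq P) -> altern q.+1 (on_seq Q) ->
  on_seq (nr_bracket P Q) = br p q (on_seq P) (on_seq Q).
Proof.
move=> hP hQ.
by rewrite /nr_bracket on_seqD on_seqN on_seqZ on_seq_cast !on_seq_nr_comp.
Qed.

End NrSequences.

(** * Homogeneous maps on a direct sum *)

Section UnshuffleSumMaps.
Variables (K : fieldType) (U W W' : lmodType K).

Lemma unshuffle_sum_map (h : U -> U) k s (Phi : seq U -> seq U -> W) :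
  unshuffle_sum k (map h s) Phi = unshuffle_sum k s (fun A B => Phi (map h A) (map h B)).
Proof. by elim: s k Phi => //= u s IH k Phi; rewrite !IH. Qed.

Lemma unshuffle_sum_linear (h : W -> W') k s (Phi : seq U -> seq U -> W) :
  linear h -> h (unshuffle_sum k s Phi) = unshuffle_sum k s (fun A B => h (Phi A B)).
Proof.
move=> hl; elim: s k Phi => //= u s IH k Phi.
by rewrite addrC hl !IH addrC.
Qed.

Lemma altern_linear_comp n (F : seq U -> W) (h : W -> W') :
  linear h -> altern n F -> altern n (fun s => h (F s)).
Proof.
move=> hl [F0 F1 F2].
have h0 : h 0 = 0.
  by have := hl (-1) 0 0; rewrite scaler0 addr0 scaleN1r addNr.
by split=> [s hs|s1 s2 a u v|s1 s2 u]; [rewrite F0|rewrite F1 hl|rewrite F2].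
Qed.

Lemma altern_scale_all n (F : seq U -> W) c s :
  altern n F -> F (map ( *:%R c) s) = c ^+ n *: F s.
Proof.
move=> hF; have [sn|ns] := eqVneq (size s) n; last first.
  by rewrite !(altern_size hF) ?size_map // scaler0.
rewrite -sn; have E s1 : F (s1 ++ map ( *:%R c) s) = c ^+ size s *: F (s1 ++ s).
  elim: s s1 {sn} => [|u s IH] s1 /=; first by rewrite expr0 scale1r.
  rewrite (altern_scale _ _ _ _ hF).
  have := IH (s1 ++ [:: u]); rewrite -!catA /= => ->.
  by rewrite scalerA -exprS.
exact: (E [::]).
Qed.

End UnshuffleSumMaps.

Section Weights.
Variables (K : fieldType) (g V : lmodType K).
Hypothesis charK0 : [pchar K] =i pred0.
Local Notation gV := (g * V)%type.
Implicit Types (z : gV).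

Lemma natr_neq0 n : (0 < n)%N -> (n%:R : K) != 0.
Proof. by move=> n0; rewrite (proj1 (pcharf0P K) charK0) -lt0n. Qed.

Lemma two_neq0 : (2%:R : K) != 0. Proof. exact: natr_neq0. Qed.

Lemma pow2_inj i j : (2%:R ^+ i = 2%:R ^+ j :> K) -> i = j.
Proof.
wlog ij : i j / (i <= j)%N.
  by move=> H e; case: (leqP i j) => [/H|/ltnW/H] -> //.
move=> /eqP; rewrite -!natrX -subr_eq0 -opprB oppr_eq0 -natrB ?leq_pexp2l //.
rewrite (proj1 (pcharf0P K) charK0) subn_eq0 leq_exp2l // => ji.
by apply/eqP; rewrite eqn_leq ij ji.
Qed.

(** Only the factor 2 is used, rather than a variable one: in characteristic 0 its
    powers are distinct, hence they separate the degrees. *)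
Definition dilate (z : gV) : gV := (z.1, (2%:R : K) *: z.2).
Definition inl_part (z : gV) : gV := (z.1, 0).
Definition inr_part (z : gV) : gV := (0, z.2).

Lemma part_split z : z = inl_part z + inr_part z.
Proof. by case: z => x v; congr pair; rewrite /= ?addr0 ?add0r. Qed.

Lemma dilate_inl z : dilate (inl_part z) = inl_part z.
Proof. by rewrite /dilate /inl_part /= scaler0. Qed.

Lemma dilate_inr z : dilate (inr_part z) = (2%:R : K) *: inr_part z.
Proof. by congr pair; rewrite /= scaler0. Qed.

Section Homog.
Variable W : lmodType K.
Implicit Type G : seq gV -> W.

Definition homog (c : K) G := forall s, G (map dilate s) = c *: G s.

Lemma homog_inl c G z : homog c G -> homog c (contract (inl_part z) G).
Proof. by move=> hG s; rewrite /contract -hG /= dilate_inl. Qed.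

(** A contraction by an element of V uses up one of the arguments that carry a
    factor 2. *)
Lemma homog_inr n c G z : altern n G -> homog c G ->
  homog (c / 2%:R) (contract (inr_part z) G).
Proof.
move=> aG hG s; rewrite /contract mulrC -scalerA -hG /= dilate_inr.
by rewrite (altern_scale [::] _ _ _ aG) scalerA mulVf ?two_neq0 // scale1r.
Qed.

(** A map of n arguments can only have the eigenvalues 1, 2, ..., 2^n, according
    to the number of arguments in V.  Splitting the first argument into its parts
    in g and V reduces n. *)
Lemma homog_vanish n c G : altern n G -> homog c G ->
  (forall j, (j <= n)%N -> c != 2%:R ^+ j) -> G = 0.
Proof.
elim: n c G => [|n IH] c G aG hG hc; apply: (altern_eq aG (altern0 _ _ _)).
  case=> // _; have := hG [::] => /= /eqP.
  rewrite eq_sym -subr_eq0 -[X in _ - X]scale1r -scalerBl scaler_eq0 subr_eq0.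
  by have := hc 0%N isT; rewrite expr0 => /negPf -> /= /eqP.
case=> // z s _; rewrite {1}(part_split z) (altern_addl [::] _ _ _ aG) /=.
have h1 : contract (inl_part z) G = 0.
  apply: (IH c _ (altern_contract _ aG) (homog_inl _ hG)) => j jn.
  by apply: hc; exact: leqW.
have h2 : contract (inr_part z) G = 0.
  apply: (IH _ _ (altern_contract _ aG) (homog_inr _ aG hG)) => j jn.
  by rewrite -(can_eq (mulfK two_neq0)) divfK ?two_neq0 // -exprSr; apply: hc.
have := congr1 (@^~ s) h1; have := congr1 (@^~ s) h2; rewrite /contract => -> ->.
by rewrite addr0.
Qed.

Lemma homog_gt n l G : altern n G -> homog (2%:R ^+ l) G -> (n < l)%N -> G = 0.
Proof.
move=> aG hG nl; apply: (homog_vanish aG hG) => j jn.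
by apply/eqP => /pow2_inj e; move: nl; rewrite e ltnNge jn.
Qed.

(** When each argument lies in g or in V, multilinearity dictates the eigenvalue. *)
Lemma homog_pure k l G A B : altern (k + l)%N G -> homog (2%:R ^+ l) G ->
  size B != l -> G (map inl_part A ++ map inr_part B) = 0.
Proof.
move=> aG hG sB.
have := hG (map inl_part A ++ map inr_part B).
rewrite map_cat -!map_comp (eq_map (dilate_inl : dilate \o inl_part =1 _)).
have E s1 : G (s1 ++ map (dilate \o inr_part) B) = 2%:R ^+ size B *: G (s1 ++ map inr_part B).
  elim: B s1 {sB} => [|z B IH] s1 /=; first by rewrite expr0 scale1r.
  rewrite dilate_inr (altern_scale _ _ _ _ aG).
  have := IH (s1 ++ [:: inr_part z]); rewrite -!catA /= => ->.
  by rewrite scalerA -exprS.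
rewrite E => /eqP; rewrite -subr_eq0 -scalerBl scaler_eq0 subr_eq0.
by case/orP => /eqP // /pow2_inj e; rewrite e eqxx in sB.
Qed.

(** Expanding every argument as the sum of its parts in g and V yields one term
    for each splitting of the arguments.  The term of a splitting (A, B) is
    sorted by moving A in front of B, and only the splittings with B of length l
    survive. *)
Lemma homog_decomp k l G s : altern (k + l)%N G -> homog (2%:R ^+ l) G ->
  G s = unshuffle_sum k s (fun A B => G (map inl_part A ++ map inr_part B)).
Proof.
elim: s k l G => [|z s IH] k l G aG hG //=.
rewrite {1}(part_split z) (altern_addl [::] _ _ _ aG) /=; congr (_ + _).
  have aG' := altern_contract (inl_part z) aG; have hG' := homog_inl z hG.
  case: k aG aG' => [|k] aG aG'; last exact: (IH k l _ aG' hG').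
  (* Without arguments in g left, the contraction has too large a weight. *)
  have c0 : contract (inl_part z) G = 0.
    case: l aG aG' hG hG' => [|l] aG aG' hG hG'.
      exact: (altern0_contract _ aG).
    by apply: (homog_gt aG' hG'); rewrite /= ltnSn.
  have c0' t : G (inl_part z :: t) = 0 by exact: (congr1 (@^~ t) c0).
  by rewrite c0' unshuffle_sum_eq0.
have aG' := altern_contract (inr_part z) aG; have hG' := homog_inr z aG hG.
have move_z A B : G (inr_part z :: A ++ B) = (-1) ^+ size A *: G (A ++ inr_part z :: B).
  have E s1 : G (s1 ++ inr_part z :: A ++ B) = (-1) ^+ size A *: G (s1 ++ A ++ inr_part z :: B).
    elim: A s1 => [|a A IHA] s1 /=; first by rewrite expr0 scale1r.
    rewrite (altern_swap _ _ _ _ aG).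
    have := IHA (s1 ++ [:: a]); rewrite -!catA /= => ->.
    by rewrite exprS mulN1r scaleNr.
  exact: (E [::]).
case: l aG aG' hG hG' => [|l] aG aG' hG hG'.
  (* Without arguments in V left, the eigenvalue 1/2 of the contraction is not
     attained. *)
  have c0 : contract (inr_part z) G = 0.
    apply: (homog_vanish aG' hG') => j _; rewrite expr0 div1r.
    apply/eqP => /(congr1 ( *%R^~ 2%:R)); rewrite mulVf ?two_neq0 // -exprSr -(expr0 2%:R).
    by move=> /pow2_inj.
  have c0' t : G (inr_part z :: t) = 0 by exact: (congr1 (@^~ t) c0).
  rewrite c0' unshuffle_sum_eq0 ?scaler0 // => A B _.
  have := move_z (map inl_part A) (map inr_part B); rewrite c0'.
  by move=> /esym/eqP; rewrite scaler_eq0 signr_eq0 => /eqP.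
rewrite addnS /= in aG'; rewrite exprSr mulfK ?two_neq0 // in hG'.
rewrite -[LHS]/(contract (inr_part z) G s) (IH k l _ aG' hG').
have zl : linear ( *:%R ((-1) ^+ k : K) : W -> W).
  by move=> c u v; rewrite scalerDr !scalerA mulrC.
rewrite [RHS](unshuffle_sum_linear _ _ _ zl); apply: unshuffle_sum_ext => A B _.
have [sB|sB] := eqVneq (size B) l; last first.
  by rewrite (homog_pure _ aG' hG' sB) (homog_pure _ (B := z :: B) aG hG) ?scaler0 //.
have [sA|sA] := eqVneq (size A) k.
  by rewrite [LHS]move_z size_map sA.
by rewrite [LHS]move_z (altern_size aG) ?scaler0 // size_cat /= !size_map sB eqn_add2r.
Qed.

(** This lemma and the next say that the image of the hat embedding is an
    eigenspace. *)
Lemma homog_hat k l (f : ('I_k -> g) -> ('I_l -> V) -> W) :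
  mixed_hom f -> altern (k + l)%N (on_seq (hat f)) /\ homog (2%:R ^+ l) (on_seq (hat f)).
Proof.
move=> [f1 f2].
pose Phi (A B : seq gV) := if (size A == k) && (size B == l) then
  f (fun i => (A`_i).1) (fun j => (B`_j).2) else 0.
have E : on_seq (hat f) = (fun s => unshuffle_sum k s Phi).
  by apply/funext => s; exact: (shuffle_unshuffle_sum
    (fun (y : 'I_k -> gV) (z : 'I_l -> gV) => f (fun i => (y i).1) (fun j => (z j).2))).
have alt_fst B : altern k (Phi^~ B).
  have [sB|nB] := eqVneq (size B) l; last first.
    rewrite (_ : Phi^~ B = 0); first exact: altern0.
    by apply/funext => A; rewrite /Phi (negPf nB) andbF.
  have [h0 h1 h2] := altern_on_seq (f1 (fun j => (B`_j).2)).
  have PhiE A : Phi A B = on_seq (fun y => f y (fun j => (B`_j).2)) (map fst A).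
    rewrite /Phi /on_seq sB eqxx andbT size_map; case: eqP => // sA.
    by congr f; apply/funext => i; rewrite (nth_map 0) ?sA.
  split=> [A sA|s1 s2 c u v|s1 s2 u]; rewrite !PhiE.
  - by rewrite h0 // size_map.
  - by rewrite !map_cat /= h1.
  - by rewrite !map_cat /= h2.
have alt_snd A : altern l (Phi A).
  have [sA|nA] := eqVneq (size A) k; last first.
    rewrite (_ : Phi A = 0); first exact: altern0.
    by apply/funext => B; rewrite /Phi (negPf nA).
  have [h0 h1 h2] := altern_on_seq (f2 (fun i => (A`_i).1)).
  have PhiE B : Phi A B = on_seq (f (fun i => (A`_i).1)) (map snd B).
    rewrite /Phi /on_seq sA eqxx /= size_map; case: eqP => // sB.
    by congr f; apply/funext => i; rewrite (nth_map 0) ?sB.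
  split=> [B sB|s1 s2 c u v|s1 s2 u]; rewrite !PhiE.
  - by rewrite h0 // size_map.
  - by rewrite !map_cat /= h1.
  - by rewrite !map_cat /= h2.
split; first by rewrite E; exact: altern_unshuffle_sum.
move=> s; rewrite E unshuffle_sum_map.
have zl : linear ( *:%R (2%:R ^+ l : K) : W -> W).
  by move=> c u v; rewrite scalerDr !scalerA mulrC.
rewrite [RHS](unshuffle_sum_linear _ _ _ zl); apply: unshuffle_sum_ext => A B _.
rewrite /Phi !size_map; case: andP => [[/eqP sA /eqP sB]|_]; last by rewrite scaler0.
have := altern_scale_all 2%:R (map snd B) (altern_on_seq (f2 (fun i => (A`_i).1))).
rewrite /on_seq !size_map sB eqxx.
have -> : (fun i : 'I_l => (map ( *:%R 2%:R) (map snd B))`_i)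
        = (fun j : 'I_l => ((map dilate B)`_j).2).
  by apply/funext => j; rewrite -map_comp !(nth_map 0) ?sB.
have -> : (fun i : 'I_l => (map snd B)`_i) = (fun j : 'I_l => (B`_j).2).
  by apply/funext => j; rewrite !(nth_map 0) ?sB.
move=> <-; congr f; apply/funext => i.
by rewrite (nth_map 0) ?sA.
Qed.

Lemma hat_homog k l G : altern (k + l)%N G -> homog (2%:R ^+ l) G ->
  exists2 f : ('I_k -> g) -> ('I_l -> V) -> W, mixed_hom f & G = on_seq (hat f).
Proof.
move=> aG hG.
(* The restriction of G to k arguments in g followed by l arguments in V. *)
pose f (x : 'I_k -> g) (v : 'I_l -> V) : W :=
  G ([seq (x i, 0) | i <- enum 'I_k] ++ [seq (0, v j) | j <- enum 'I_l]).
have inl_lin c (x y : g) : (c *: x + y, 0 : V) = c *: (x, 0) + (y, 0).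
  by congr pair; rewrite /= scaler0 addr0.
have inr_lin c (x y : V) : (0 : g, c *: x + y) = c *: (0, x) + (0, y).
  by congr pair; rewrite /= scaler0 addr0.
have [G0 G1 G2] := aG.
exists f.
  split=> [v|x].
    have -> : f^~ v = @of_seq K g W k
        (fun A => G ([seq (x, 0) | x <- A] ++ [seq (0, v j) | j <- enum 'I_l])).
      by apply/funext => x; rewrite /of_seq -map_comp.
    apply: alternating_of_seq; split=> [A sA|s1 s2 c a b|s1 s2 a].
    - by rewrite G0 // size_cat 2!size_map size_enum_ord eqn_add2r.
    - by rewrite !map_cat /= inl_lin -!catA /= G1.
    - by rewrite !map_cat /= -!catA /= G2.
  have -> : f x = @of_seq K V W l
      (fun B => G ([seq (x i, 0) | i <- enum 'I_k] ++ [seq (0, v) | v <- B])).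
    by apply/funext => v; rewrite /of_seq -map_comp.
  apply: alternating_of_seq; split=> [B sB|s1 s2 c a b|s1 s2 a].
  - by rewrite G0 // size_cat size_map size_enum_ord size_map eqn_add2l.
  - by rewrite !map_cat /= inr_lin !catA G1.
  - by rewrite !map_cat /= catA G2.
apply/funext => s; rewrite (homog_decomp s aG hG).
rewrite (shuffle_unshuffle_sum
    (fun (y : 'I_k -> gV) (z : 'I_l -> gV) => f (fun i => (y i).1) (fun j => (z j).2))).
apply: unshuffle_sum_ext => A B _.
case: andP => [[/eqP sA /eqP sB]|h]; last first.
  have [sB|sB] := eqVneq (size B) l; last by rewrite (homog_pure _ aG hG).
  have [sA|sA] := eqVneq (size A) k; first by case: h; rewrite sA sB.
  by rewrite G0 // size_cat !size_map sB eqn_add2r.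
rewrite /f; congr (G (_ ++ _)).
  by rewrite -{1}(map_enum_nth sA) -map_comp.
by rewrite -{1}(map_enum_nth sB) -map_comp.
Qed.

End Homog.
End Weights.

(** * The cochain spaces as spaces of homogeneous alternating maps *)

Section Cochains.
Variables (K : fieldType) (g V : lmodType K).
Hypothesis charK0 : [pchar K] =i pred0.
Local Notation gV := (g * V)%type.
Implicit Types (F P Q : seq gV -> gV).

Lemma dilate_linear : linear (@dilate K g V).
Proof.
move=> a [x v] [y w]; congr pair => /=.
by rewrite scalerDr !scalerA mulrC.
Qed.

(** The weight of a map is the number of its arguments in V minus the number of
    its values in V (0 or 1). *)
Definition weight w F := forall s, F (map (@dilate K g V) s) = 2%:R ^+ w *: dilate (F s).

Lemma weight_comb w a F P : weight w F -> weight w P -> weight w (a *: F + P).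
Proof.
move=> hF hP s; rewrite !fctE hF hP dilate_linear scalerDr !scalerA.
by rewrite (mulrC a).
Qed.

Lemma weight_0 w : weight w 0.
Proof. by move=> s; rewrite /dilate /=; congr pair; rewrite /= !scaler0. Qed.

Lemma weightD w F P : weight w F -> weight w P -> weight w (F + P).
Proof. by move=> hF; rewrite -[F]scale1r; exact: weight_comb. Qed.

Lemma weightZ w a F : weight w F -> weight w (a *: F).
Proof. by move=> hF; rewrite -[a *: F]addr0; apply: weight_comb => //; exact: weight_0. Qed.

Lemma weight_circ a b w w' P Q : altern a P -> weight w P -> weight w' Q ->
  weight (w + w')%N (circ b P Q).
Proof.
move=> aP hP hQ s; rewrite /circ unshuffle_sum_map.
have hl : linear (fun z : gV => 2%:R ^+ (w + w') *: dilate z).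
  by move=> c u v; rewrite dilate_linear scalerDr !scalerA mulrC.
rewrite [RHS](unshuffle_sum_linear _ _ _ hl); apply: unshuffle_sum_ext => A B _.
rewrite hQ (altern_scale [::] _ _ _ aP) /= -[_ :: _]/(map (@dilate K g V) (Q A :: B)).
by rewrite hP scalerA -exprD addnC.
Qed.

Lemma weight_br p q w w' P Q : altern p.+1 P -> altern q.+1 Q ->
  weight w P -> weight w' Q -> weight (w + w')%N (br p q P Q).
Proof.
move=> aP aQ hP hQ; apply: weightD; first exact: weight_circ aP hP hQ.
rewrite -scaleNr; apply: weightZ; rewrite addnC; exact: weight_circ aQ hQ hP.
Qed.

Lemma fst_linear : linear (fst : gV -> g). Proof. by []. Qed.
Lemma snd_linear : linear (snd : gV -> V). Proof. by []. Qed.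

Lemma weightP w F :
  weight w F <-> homog (2%:R ^+ w) (fst \o F) /\ homog (2%:R ^+ w.+1) (snd \o F).
Proof.
split=> [hF|[h1 h2] s].
  by split=> s; rewrite /= hF //= scalerA -exprSr.
have := h1 s; have := h2 s; rewrite /= exprSr -scalerA.
by case: (F _) => x v /= -> ->.
Qed.

Lemma alternP n F : altern n F <-> altern n (fst \o F) /\ altern n (snd \o F).
Proof.
split=> [hF|[[a0 a1 a2] [b0 b1 b2]]].
  by split; [exact: altern_linear_comp fst_linear hF|exact: altern_linear_comp snd_linear hF].
have pairE (z z' : gV) : z.1 = z'.1 -> z.2 = z'.2 -> z = z'.
  by case: z z' => [x v] [y w] /= -> ->.
split=> [s hs|s1 s2 c u v|s1 s2 u]; apply: pairE.
- exact: a0.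
- exact: b0.
- exact: a1.
- exact: b1.
- exact: a2.
- exact: b2.
Qed.

(** The weight is at most the number of arguments in V. *)
Lemma weight_gt n w F : altern n F -> weight w F -> (n < w)%N -> F = 0.
Proof.
move=> /alternP[aF1 aF2] /weightP[h1 h2] nw; apply/funext => s.
have e1 := congr1 (@^~ s) (homog_gt charK0 aF1 h1 nw).
have e2 := congr1 (@^~ s) (homog_gt charK0 aF2 h2 (leqW nw)).
by move: e1 e2; rewrite /=; case: (F s) => x v /= -> ->.
Qed.

Lemma fst_on_seq n (f : ('I_n -> gV) -> gV) : fst \o on_seq f = on_seq (fun x => (f x).1).
Proof. by apply/funext => s; rewrite /= /on_seq; case: ifP. Qed.

Lemma snd_on_seq n (f : ('I_n -> gV) -> gV) : snd \o on_seq f = on_seq (fun x => (f x).2).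
Proof. by apply/funext => s; rewrite /= /on_seq; case: ifP. Qed.

(** The pair that governs the complex: pi has arity 2 and weight 0, T has arity 1
    and weight 1, and an n-cochain (f, theta) consists of maps of arity n and
    weight 0 and of arity n - 1 and weight n - 1. *)
Definition bideg (n w : nat) F := altern n F /\ weight w F.

Lemma bidegP n w (f : ('I_n -> gV) -> gV) :
  bideg n w (on_seq f) <->
  (altern n (on_seq (fun x => (f x).1)) /\ homog (2%:R ^+ w) (on_seq (fun x => (f x).1))) /\
  (altern n (on_seq (fun x => (f x).2)) /\ homog (2%:R ^+ w.+1) (on_seq (fun x => (f x).2))).
Proof.
rewrite /bideg alternP weightP fst_on_seq snd_on_seq; tauto.
Qed.

Lemma bideg_hat_pair n fg fV : @mixed_hom K n.+1 0 g V g fg -> @mixed_hom K n 1 g V V fV ->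
  bideg n.+1 0 (on_seq (cast_arity (addn0 n.+1) (hat_g fg) + cast_arity (addn1 n) (hat_V fV)
                  : nr gV n)).
Proof.
move=> /homog_hat[a1 h1] /homog_hat[a2 h2]; apply/bidegP.
have -> : (fun x => ((cast_arity (addn0 n.+1) (hat_g fg)
     + cast_arity (addn1 n) (hat_V fV) : nr gV n) x).1) = cast_arity (addn0 n.+1) (hat fg).
  by apply/funext => x; rewrite /= addr0.
have -> : (fun x => ((cast_arity (addn0 n.+1) (hat_g fg)
     + cast_arity (addn1 n) (hat_V fV) : nr gV n) x).2) = cast_arity (addn1 n) (hat fV).
  by apply/funext => x; rewrite /= add0r.
rewrite !on_seq_cast; split; split=> //; first exact: (altern_arity a1 (addn0 _)).
exact: (altern_arity a2 (addn1 _)).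
Qed.

(** A map of weight 0 has no argument in V if its value is in g, and exactly one
    if its value is in V. *)
Lemma bideg_pair_hat n (f : nr gV n) : bideg n.+1 0 (on_seq f) ->
  exists fg fV, [/\ @mixed_hom K n.+1 0 g V g fg, @mixed_hom K n 1 g V V fV
    & f = (cast_arity (addn0 n.+1) (hat_g fg) : nr gV n) + cast_arity (addn1 n) (hat_V fV)].
Proof.
move=> /bidegP[[a1 h1] [a2 h2]].
have [fg Hg eg] := hat_homog charK0 (altern_arity a1 (esym (addn0 n.+1))) h1.
have [fV HV eV] := hat_homog charK0 (altern_arity a2 (esym (addn1 n))) h2.
exists fg, fV; split=> //.
rewrite -(on_seq_cast (addn0 n.+1)) in eg; rewrite -(on_seq_cast (addn1 n)) in eV.
move/on_seq_inj: eg => eg; move/on_seq_inj: eV => eV.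
apply/funext => x; have := congr1 (@^~ x) eg; have := congr1 (@^~ x) eV => /=.
rewrite fctE /cast_arity /hat_g /hat_V /=; case: (f x) => y v /= -> ->.
by congr pair; rewrite /= ?addr0 ?add0r.
Qed.

Lemma bideg_hat_theta n th : @mixed_hom K 0 n.+1 g V g th ->
  bideg n.+1 n.+1 (on_seq (hat_g th : nr gV n)).
Proof.
move=> /homog_hat[a1 h1]; apply/bidegP; split=> //.
have -> : (fun x => ((hat_g th : nr gV n) x).2) = 0 by [].
rewrite on_seq0; split; first exact: altern0.
by move=> s; rewrite scaler0.
Qed.

(** The weight equals the arity, so that all arguments are in V; a value in V
    would require one argument more. *)
Lemma bideg_theta_hat n (f : nr gV n) : bideg n.+1 n.+1 (on_seq f) ->
  exists2 th, @mixed_hom K 0 n.+1 g V g th & f = hat_g th.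
Proof.
move=> /bidegP[[a1 h1] [a2 h2]].
have [th Hth eth] := hat_homog (k := 0) charK0 a1 h1.
exists th => //; move/on_seq_inj: eth => eth.
have := homog_gt charK0 a2 h2 (ltnSn _); rewrite -(on_seq0 _ _ n.+1) => /on_seq_inj e2.
apply/funext => x; have := congr1 (@^~ x) eth; have := congr1 (@^~ x) e2 => /=.
by rewrite /hat_g; case: (f x) => y v /= -> ->.
Qed.

Lemma cochain2P m (c : ambient g V m.+2) :
  cochain c <-> bideg m.+2 0 (on_seq c.1) /\ bideg m.+1 m.+1 (on_seq c.2).
Proof.
split=> [[fg [fV [th [hg hV hth -> ->]]]]|[/bideg_pair_hat[fg [fV [hg hV e1]]]
    /bideg_theta_hat[th hth e2]]].
  by split; [exact: bideg_hat_pair|exact: bideg_hat_theta].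
by exists fg, fV, th.
Qed.

Lemma multilinear1 (U W : lmodType K) (f : ('I_1 -> U) -> W) :
  alternating_multilinear f <-> linear (fun u => f (fun _ => u)).
Proof.
have E (x : 'I_1 -> U) i u : [eta x with i |-> u] = (fun _ => u) :> (_ -> _).
  by apply/funext => j /=; rewrite (ord1 i) (ord1 j).
split=> [[f1 _] a u v|h]; first by have := f1 ord0 (fun _ => 0) a u v; rewrite !E.
split=> [i x a u v|i j x]; first by rewrite !E h.
by rewrite (ord1 i) (ord1 j).
Qed.

Lemma multilinear0 (U W : lmodType K) (f : ('I_0 -> U) -> W) : alternating_multilinear f.
Proof. by split=> -[]. Qed.

Lemma cast_arity_id (U W : Type) n (e : n = n) (f : ('I_n -> U) -> W) :
  cast_arity e f = f.
Proof.
apply/funext => x; congr f; apply/funext => i; congr x; exact: val_inj.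
Qed.

Lemma cochain1P (f : ambient g V 1) : @cochain K g V 1 f <-> bideg 1 0 (on_seq f).
Proof.
split=> [[a [b ->]]|].
  have := @bideg_hat_pair 0 (fun (x : 'I_1 -> g) (_ : 'I_0 -> V) => a (x ord0))
    (fun (_ : 'I_0 -> g) (v : 'I_1 -> V) => b (v ord0)).
  rewrite !cast_arity_id; apply; split=> y; try exact: multilinear0.
    by apply/multilinear1 => c u v; rewrite linearP.
  by apply/multilinear1 => c u v; rewrite linearP.
move=> /bideg_pair_hat[fg [fV [[hg _] [_ hV] ->]]].
pose v0 : 'I_0 -> V := fun _ => 0.
pose x0 : 'I_0 -> g := fun _ => 0.
have lg := proj1 (multilinear1 _) (hg v0).
have lV := proj1 (multilinear1 _) (hV x0).
pose a : {linear g -> g} :=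
  HB.pack (fun u => fg (fun _ => u) v0) (GRing.isLinear.Build _ _ _ _ _ lg).
pose b : {linear V -> V} :=
  HB.pack (fun u => fV x0 (fun _ => u)) (GRing.isLinear.Build _ _ _ _ _ lV).
have eg : fg = (fun x _ => a (x ord0)).
  apply/funext => y; apply/funext => v /=; congr (fg _ _); apply/funext; last by case.
  by move=> i; rewrite (ord1 i).
have eV : fV = (fun _ v => b (v ord0)).
  apply/funext => y; apply/funext => v /=; congr (fV _ _); apply/funext; first by case.
  by move=> i; rewrite (ord1 i).
exists a, b; rewrite !cast_arity_id.
by congr (_ + _); [exact: (congr1 (@hat_g K 1 0 g V) eg)
                 |exact: (congr1 (@hat_V K 0 1 g V) eV)].
Qed.

End Cochains.

(** * The cochain complex of a relative Rota-Baxter Lie algebra *)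

Section Complex.
Variables (K : fieldType) (charK0 : [pchar K] =i pred0).
Variables (g V : lmodType K) (A : rel_rota_baxter_lie g V).
Local Notation gV := (g * V)%type.
Local Notation mu := (rb_mu A).
Local Notation rho := (rb_rho A).
Local Notation T := (rb_T A).
Let piS : seq gV -> gV := on_seq (rb_pi A).
Let TS : seq gV -> gV := on_seq (rb_That A).

Lemma pair_eq (z z' : gV) : z.1 = z'.1 -> z.2 = z'.2 -> z = z'.
Proof. by case: z z' => [x v] [y w] /= -> ->. Qed.

Lemma mu_addl x y z : mu (x + y) z = mu x z + mu y z.
Proof. by have [l _ _ _] := rb_muP A; have := l z 1 x y; rewrite !scale1r. Qed.

Lemma mu_addr x y z : mu z (x + y) = mu z x + mu z y.
Proof. by have [_ l _ _] := rb_muP A; have := l z 1 x y; rewrite !scale1r. Qed.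

Lemma mu_oppr x y : mu x (- y) = - mu x y.
Proof.
have [_ l _ _] := rb_muP A; have := l x (-1) y 0.
rewrite !addr0 !scaleN1r => ->; have := l x (-1) 0 0.
by rewrite scaler0 addr0 scaleN1r addNr => ->; rewrite addr0.
Qed.

Lemma mu0l x : mu 0 x = 0.
Proof. by apply: (addrI (mu 0 x)); rewrite -mu_addl !addr0. Qed.

Lemma rho0l v : rho 0 v = 0.
Proof.
have [l _] := rb_rhoP A; have := l (-1) 0 0 v.
by rewrite scaler0 addr0 scaleN1r addNr.
Qed.

Lemma mu_skew x y : mu x y = - mu y x.
Proof.
have [_ _ h _] := rb_muP A; have := h (x + y).
by rewrite mu_addl !mu_addr !h add0r addr0 => /eqP; rewrite addr_eq0 => /eqP.
Qed.

Lemma alternating_mu : alternating_multilinear (fun x : 'I_2 -> g => mu (x ord0) (x ord_max)).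
Proof.
have [l r h _] := rb_muP A.
have I2 (i : 'I_2) : i = ord0 \/ i = ord_max.
  by case: i => -[|[|//]] hi; [left|right]; apply: val_inj.
split=> [i x a u v|i j x] /=.
  by case: (I2 i) => ->; rewrite /= ?l ?r.
by case: (I2 i) => ->; case: (I2 j) => -> //= _ ->; rewrite h.
Qed.

Lemma bideg_pi : bideg 2 0 piS.
Proof.
have [r1 _] := rb_rhoP A.
have := @bideg_hat_pair K g V 1
  (fun (x : 'I_2 -> g) (_ : 'I_0 -> V) => mu (x ord0) (x ord_max))
  (fun (x : 'I_1 -> g) (v : 'I_1 -> V) => rho (x ord0) (v ord0)).
rewrite !cast_arity_id; apply; split=> y; try exact: multilinear0.
- exact: alternating_mu.
- by apply/multilinear1 => c u v; rewrite r1.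
- by apply/multilinear1 => c u v; rewrite linearP.
Qed.

Lemma bideg_T : bideg 1 1 TS.
Proof.
apply: (@bideg_hat_theta K g V 0); split=> y; first exact: multilinear0.
by apply/multilinear1 => c u v; rewrite linearP.
Qed.

Lemma piE z1 z2 : piS [:: z1; z2] = (mu z1.1 z2.1, rho z1.1 z2.2 - rho z2.1 z1.2).
Proof.
have hg := @shuffle_unshuffle_sum K gV g 2 0 (fun (y : 'I_2 -> gV) (_ : 'I_0 -> gV) =>
  mu (y ord0).1 (y ord_max).1) [:: z1; z2].
have hV := @shuffle_unshuffle_sum K gV V 1 1 (fun (y : 'I_1 -> gV) (w : 'I_1 -> gV) =>
  rho (y ord0).1 (w ord0).2) [:: z1; z2].
rewrite /= in hg hV.
rewrite /on_seq /= in hg hV.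
rewrite /piS /on_seq /= /rb_pi !fctE /hat_g /hat_V /hat; congr pair.
  by rewrite /= addr0; etransitivity; first exact: hg; rewrite !(scaler0, addr0).
rewrite /= add0r; etransitivity; first exact: hV.
by rewrite scaler0 addr0 add0r scale1r scaleN1r.
Qed.

Lemma TE z : TS [:: z] = (T z.2, 0).
Proof.
have hT := @shuffle_unshuffle_sum K gV g 0 1 (fun (_ : 'I_0 -> gV) (y : 'I_1 -> gV) =>
  T (y ord0).2) [:: z].
rewrite /on_seq /= in hT.
rewrite /TS /on_seq /= /rb_That /hat_g /hat; congr pair.
by etransitivity; first exact: hT; rewrite add0r scale1r.
Qed.

Lemma pi_size s : size s != 2%N -> piS s = 0.
Proof. by have [h _] := bideg_pi; exact: altern_size h. Qed.

(** On three arguments, the component in g is the Jacobi identity of mu, and the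
    component in V is the compatibility of rho with mu. *)
Lemma br_pi_pi : br 1 1 piS piS = 0.
Proof.
have [hp _] := bideg_pi.
have [_ _ _ jac] := rb_muP A; have [_ rm] := rb_rhoP A.
have c0 : circ 2 piS piS = 0.
  apply: (altern_eq (altern_circ hp hp) (altern0 _ _ _)) => -[|z1 [|z2 [|z3 []]]] //= _.
  rewrite /circ /=.
  have p0l z : piS [:: 0; z] = 0 by exact: (altern_nil0 [::] _ hp).
  have p0 : piS [::] = 0 by exact: pi_size.
  have p1 z : piS [:: z] = 0 by exact: pi_size.
  have p3 a b c : piS [:: a; b; c] = 0 by exact: pi_size.
  have p4 a b c d : piS [:: a; b; c; d] = 0 by exact: pi_size.
  rewrite !(p0, p1, p3, p4, p0l) !piE /= !(scaler0, addr0, add0r).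
  rewrite !signE /= !(scale1r, scaleN1r).
  apply: pair_eq => /=.
    rewrite !(mu_skew (mu _ _)) -(oppr0) -(jac z1.1 z2.1 z3.1) (mu_skew z3.1 z1.1).
    by rewrite mu_oppr; zmod.
  by rewrite !rm !raddfB /=; zmod.
rewrite /br c0 scaler0 subr0 //.
Qed.

Lemma br_T_E P z1 z2 : altern 2 P ->
  br 1 0 P TS [:: z1; z2] =
  P [:: TS [:: z1]; z2] - P [:: TS [:: z2]; z1] - TS [:: P [:: z1; z2]].
Proof.
move=> hP; have [ht _] := bideg_T.
have t0 : TS [::] = 0 by exact: (altern_size ht).
have t2 a b : TS [:: a; b] = 0 by exact: (altern_size ht).
have t3 a b c : TS [:: a; b; c] = 0 by exact: (altern_size ht).
have P1 a : P [:: a] = 0 by exact: (altern_size hP).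
have P3 a b c : P [:: a; b; c] = 0 by exact: (altern_size hP).
rewrite /br !fctE /circ /= !(P1, P3, t0, t2, t3) !signE /=.
by rewrite !(scaler0, addr0, add0r, scale1r, scaleN1r, oppr0).
Qed.

(** On two arguments this is twice the Rota-Baxter identity. *)
Lemma br_pi_T_T : br 1 0 (br 1 0 piS TS) TS = 0.
Proof.
have [hp _] := bideg_pi; have [ht _] := bideg_T.
have hpt : altern 2 (br 1 0 piS TS) := altern_br hp ht.
have hptt : altern 2 (br 1 0 (br 1 0 piS TS) TS) := altern_br hpt ht.
apply: (altern_eq hptt (altern0 _ _ _)) => -[|z1 [|z2 []]] //= _.
rewrite !br_T_E // !TE !piE /=; apply: pair_eq => /=.
  rewrite !linear0 !(mu0l, addr0, add0r) mu_skew (rb_TP A) !raddfB /=; zmod.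
by rewrite !(linear0, rho0l, addr0).
Qed.

Lemma bideg_comb n w a (F G : seq gV -> gV) :
  bideg n w F -> bideg n w G -> bideg n w (a *: F + G).
Proof. by move=> [aF wF] [aG wG]; split; [exact: altern_comb|exact: weight_comb]. Qed.

Lemma bidegZ n w a (F : seq gV -> gV) : bideg n w F -> bideg n w (a *: F).
Proof. by move=> [aF wF]; split; [exact: alternZ|exact: weightZ]. Qed.

Lemma bideg_br k l w w' (P Q : seq gV -> gV) :
  bideg k.+1 w P -> bideg l.+1 w' Q -> bideg (k + l).+1 (w + w') (br k l P Q).
Proof. by move=> [aP wP] [aQ wQ]; split; [exact: altern_br|exact: weight_br]. Qed.

Let piT : seq gV -> gV := br 1 0 piS TS.

Lemma bideg_pt : bideg 2 1 piT.
Proof. exact: bideg_br bideg_pi bideg_T. Qed.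

Definition ad_T (q : nat) (F : seq gV -> gV) : seq gV -> gV := br q 0 F TS.

Lemma bideg_iter_ad q w k F : bideg q.+1 w F -> bideg q.+1 (w + k) (iter k (ad_T q) F).
Proof.
move=> hF; elim: k => [|k IH]; first by rewrite addn0.
by have := bideg_br IH bideg_T; rewrite addn0 addn1 addnS.
Qed.

Lemma iter_ad_comb q k a F G : iter k (ad_T q) (a *: F + G) =
  a *: iter k (ad_T q) F + iter k (ad_T q) G.
Proof.
have [ht _] := bideg_T.
by elim: k => //= k ->; rewrite /ad_T br_combl.
Qed.

Lemma iter_ad0 q k : iter k (ad_T q) 0 = 0.
Proof. by have [ht _] := bideg_T; elim: k => //= k ->; rewrite /ad_T br0l. Qed.

Lemma iter_adZ q k a F : iter k (ad_T q) (a *: F) = a *: iter k (ad_T q) F.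
Proof. by have := iter_ad_comb q k a F 0; rewrite iter_ad0 !addr0. Qed.

Lemma iter_adN q k F : iter k (ad_T q) (- F) = - iter k (ad_T q) F.
Proof. by rewrite -!scaleN1r iter_adZ. Qed.

Lemma br_pi_square q F : bideg q.+1 0 F -> br 1 q.+1 piS (br 1 q piS F) = 0.
Proof.
by move=> [hF _]; apply: br_square => //; [exact: two_neq0|case: bideg_pi|exact: br_pi_pi].
Qed.

Lemma br_pt_square q w F : bideg q.+1 w F -> br 1 q.+1 piT (br 1 q piT F) = 0.
Proof.
move=> [hF _]; apply: br_square => //; [exact: two_neq0|by case: bideg_pt|].
apply: br_square_derived; [exact: two_neq0|by case: bideg_pi|by case: bideg_T| |].
  exact: br_pi_pi.
exact: br_pi_T_T.
Qed.

(** By [iter_ad_br], since q+2 brackets with T kill a map of weight 0 and arity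
    q+1.  Together with the minus sign in the first component of D, this is the
    cancellation in the second component of D o D. *)
Lemma br_pt_iter_ad q F : bideg q.+1 0 F ->
  (q.+2`!%:R : K)^-1 *: iter q.+2 (ad_T q.+1) (br 1 q piS F) =
  (q.+1`!%:R : K)^-1 *: br 1 q piT (iter q.+1 (ad_T q) F).
Proof.
move=> hF; have [hp _] := bideg_pi; have [ht _] := bideg_T.
have [aF _] := hF.
rewrite (iter_ad_br q.+2 hp ht br_pi_T_T aF) -/(ad_T q).
have [a0 w0] := bideg_iter_ad q.+2 hF.
rewrite (weight_gt charK0 a0 w0) ?add0n // br0r // add0r scalerA.
congr (_ *: _); rewrite factS natrM invfM mulrAC mulVf ?mul1r //.
exact: natr_neq0.
Qed.

Lemma on_seq_bracket_T q w (f : nr gV q) : bideg q.+1 w (on_seq f) ->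
  on_seq (bracket_T A f) = ad_T q (on_seq f).
Proof.
move=> [af _]; rewrite /bracket_T on_seq_cast on_seq_nr_bracket //; by case: bideg_T.
Qed.

Lemma on_seq_iter_bracket_T q w k (f : nr gV q) : bideg q.+1 w (on_seq f) ->
  on_seq (iter k (@bracket_T K g V A q) f) = iter k (ad_T q) (on_seq f).
Proof.
move=> hf; elim: k => //= k IH.
rewrite (@on_seq_bracket_T q (w + k)) IH //; exact: bideg_iter_ad.
Qed.

Definition D_sign1 : K := (-1 : K) ^ (1%:Z - 2%:Z).
Definition D_sign m : K := (-1 : K) ^ (m.+2%:Z - 2%:Z).

Lemma on_seq_D1 (f : ambient g V 1) : cochain f ->
  on_seq (rb_D A f).1 = D_sign1 *: - br 1 0 piS (on_seq f) /\
  on_seq (rb_D A f).2 = D_sign1 *: ((1`!%:R : K)^-1 *: iter 1 (ad_T 0) (on_seq f)).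
Proof.
move=> /(cochain1P charK0) hf; have [af _] := hf; have [hp _] := bideg_pi.
split.
  by rewrite -(on_seq_nr_bracket hp af) -on_seqN -on_seqZ.
by rewrite -(on_seq_iter_bracket_T 1 hf) -!on_seqZ.
Qed.

Lemma on_seq_D2 m (c : ambient g V m.+2) : cochain c ->
  on_seq (rb_D A c).1 = D_sign m *: - br 1 m.+1 piS (on_seq c.1) /\
  on_seq (rb_D A c).2 = D_sign m *: (br 1 m piT (on_seq c.2)
      + (m.+2`!%:R : K)^-1 *: iter m.+2 (ad_T m.+1) (on_seq c.1)).
Proof.
move=> /(cochain2P charK0) [h1 h2]; have [a1 _] := h1; have [a2 _] := h2.
have [hp _] := bideg_pi; have [ht _] := bideg_T; have [hpt _] := bideg_pt.
split.
  by rewrite -(on_seq_nr_bracket hp a1) -on_seqN -on_seqZ.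
have ept : piT = on_seq (nr_bracket (rb_pi A) (rb_That A)) by rewrite on_seq_nr_bracket.
rewrite ept in hpt *.
by rewrite -(on_seq_nr_bracket hpt a2) -(on_seq_iter_bracket_T m.+2 h1) -!(on_seqZ, on_seqD).
Qed.

Lemma pair_on_seq_eq m (c d : nr gV m.+1 * nr gV m) :
  on_seq c.1 = on_seq d.1 -> on_seq c.2 = on_seq d.2 -> c = d.
Proof. by case: c d => [c1 c2] [d1 d2] /= /on_seq_inj -> /on_seq_inj ->. Qed.

Lemma bideg0 n w : @bideg K g V n w 0.
Proof. by split; [exact: altern0|exact: weight_0]. Qed.

Lemma bidegD n w (F G : seq gV -> gV) : bideg n w F -> bideg n w G -> bideg n w (F + G).
Proof. by move=> hF hG; rewrite -[F]scale1r; exact: bideg_comb. Qed.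

Lemma bidegN n w (F : seq gV -> gV) : bideg n w F -> bideg n w (- F).
Proof. by rewrite -scaleN1r; exact: bidegZ. Qed.

Lemma zero_cochain n : @cochain K g V n 0.
Proof.
case: n => [|[|m]] //; first by apply/(cochain1P charK0); rewrite on_seq0; exact: bideg0.
by apply/(cochain2P charK0); rewrite !on_seq0; split; exact: bideg0.
Qed.

Lemma comb_cochain n a (c c' : ambient g V n) :
  cochain c -> cochain c' -> cochain (a *: c + c').
Proof.
case: n c c' => [|[|m]] c c' //.
  move=> /(cochain1P charK0) h /(cochain1P charK0) h'; apply/(cochain1P charK0).
  by rewrite on_seq_comb; exact: bideg_comb.
move=> /(cochain2P charK0) [h1 h2] /(cochain2P charK0) [h1' h2'].
apply/(cochain2P charK0); rewrite [(_ + _).1]/= [(_ + _).2]/= !on_seq_comb.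
by split; exact: bideg_comb.
Qed.

Lemma rb_D_cochain n (c : ambient g V n) : cochain c -> cochain (rb_D A c).
Proof.
case: n c => [|[|m]] c hc; first exact: zero_cochain.
  have [e1 e2] := on_seq_D1 hc; have h := proj1 (cochain1P charK0 _) hc.
  apply/(cochain2P charK0); rewrite e1 e2; split.
    by apply: bidegZ; apply: bidegN; exact: bideg_br bideg_pi h.
  by do 2! apply: bidegZ; exact: (bideg_iter_ad 1 h).
have [e1 e2] := on_seq_D2 hc; have [h1 h2] := proj1 (cochain2P charK0 _) hc.
apply/(cochain2P charK0); rewrite e1 e2; split.
  by apply: bidegZ; apply: bidegN; exact: bideg_br bideg_pi h1.
apply: bidegZ; apply: bidegD; first exact: bideg_br bideg_pt h2.
by apply: bidegZ; exact: (bideg_iter_ad m.+2 h1).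
Qed.

Lemma rb_D_linear n a (c c' : ambient g V n) : cochain c -> cochain c' ->
  rb_D A (a *: c + c') = a *: rb_D A c + rb_D A c'.
Proof.
have [hp _] := bideg_pi; have [hpt _] := bideg_pt.
have sw (s r : K) (X Y : seq gV -> gV) : s *: (r *: X + Y) = r *: (s *: X) + s *: Y.
  by rewrite scalerDr !scalerA mulrC.
case: n c c' => [|[|m]] c c' hc hc'; first by rewrite /= scaler0 addr0.
  have [e1 e2] := on_seq_D1 hc; have [e1' e2'] := on_seq_D1 hc'.
  have [f1 f2] := on_seq_D1 (comb_cochain a hc hc').
  apply: pair_on_seq_eq.
    by rewrite f1 [(_ + _).1]/= !on_seq_comb e1 e1' br_combr // opprD -scalerN sw.
  by rewrite f2 [(_ + _).2]/= !on_seq_comb e2 e2' iter_ad_comb !sw.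
have [f1 f2] := on_seq_D2 (comb_cochain a hc hc').
have [e1 e2] := on_seq_D2 hc; have [e1' e2'] := on_seq_D2 hc'.
move: (rb_D A (a *: c + c')) (rb_D A c) (rb_D A c') f1 f2 e1 e2 e1' e2' => x y z.
rewrite (_ : (a *: c + c').1 = a *: c.1 + c'.1) //.
rewrite (_ : (a *: c + c').2 = a *: c.2 + c'.2) //.
rewrite !on_seq_comb => f1 f2 e1 e2 e1' e2'; apply: pair_on_seq_eq.
  rewrite (_ : (a *: y + z).1 = a *: y.1 + z.1) // on_seq_comb f1 e1 e1'.
  by rewrite br_combr // opprD -scalerN sw.
rewrite (_ : (a *: y + z).2 = a *: y.2 + z.2) // on_seq_comb f2 e2 e2'.
rewrite iter_ad_comb br_combr // -sw.
by congr (_ *: _); rewrite sw (scalerDr a (br _ _ _ _)); zmod.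
Qed.

Lemma rb_D_square n (c : ambient g V n) : cochain c -> rb_D A (rb_D A c) = 0.
Proof.
have [hp _] := bideg_pi; have [hpt _] := bideg_pt.
have swap (r s : K) (X : seq gV -> gV) : r *: (s *: X) = s *: (r *: X).
  by rewrite !scalerA mulrC.
case: n c => [|[|m]] c hc.
- have := rb_D_linear (-1) (zero_cochain 1) (zero_cochain 1).
  by rewrite scaler0 addr0 scaleN1r addNr.
- have h := proj1 (cochain1P charK0 _) hc.
  have [e1 e2] := on_seq_D1 hc; have [f1 f2] := on_seq_D2 (rb_D_cochain hc).
  apply: pair_on_seq_eq; rewrite on_seq0.
    by rewrite f1 e1 (brZr _ _ _ hp) (brNr _ _ hp) (br_pi_square h) !(scaler0, oppr0).
  rewrite f2 e1 e2 !(brZr _ _ _ hpt) iter_adZ iter_adN (swap _ D_sign1) -scalerDr.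
  by rewrite scalerN (br_pt_iter_ad h) addrN !scaler0.
have [h1 h2] := proj1 (cochain2P charK0 _) hc.
have [e1 e2] := on_seq_D2 hc; have [f1 f2] := on_seq_D2 (rb_D_cochain hc).
apply: pair_on_seq_eq; rewrite on_seq0.
  by rewrite f1 e1 (brZr _ _ _ hp) (brNr _ _ hp) (br_pi_square h1) !(scaler0, oppr0).
rewrite f2 e1 e2 (brZr _ _ _ hpt) (brDr _ _ _ hpt) (br_pt_square h2) add0r.
rewrite (brZr _ _ _ hpt) iter_adZ iter_adN (swap _ (D_sign m)) -scalerDr.
by rewrite scalerN (br_pt_iter_ad h1) addrN !scaler0.
Qed.

End Complex.

Theorem theorem4p2 (K : fieldType) (charK0 : [pchar K] =i pred0)
    (g V : lmodType K) (A : rel_rota_baxter_lie g V) :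
  cochain_complex (@cochain K g V) (@rb_D K g V A).
Proof.
split.
- exact: zero_cochain.
- exact: comb_cochain.
- exact: rb_D_cochain.
- exact: rb_D_linear.
- exact: rb_D_square.
Qed.
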